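(* Let $A$ and $B$ be C*-algebras, and let $\mathsf{X}$ be a Hilbert $A$-$B$-bimodule. Then, for any nondegenerate representation $\rho_B$ of $B$ on a Hilbert space $\mathcal{H}_0$, there are a nondegenerate representation $\lambda_A\colon A \to \mathcal{L}(\mathcal{H}_1)$ of $A$ on a Hilbert space $\mathcal{H}_1$ and a bounded linear map $\pi_{\mathsf{X}} \colon \mathsf{X} \to \mathcal{L}(\mathcal{H}_0, \mathcal{H}_1)$ such that $(\lambda_A, \rho_B, \pi_{\mathsf{X}})$ is a representation of the Hilbert $A$-$B$-bimodule $\mathsf{X}$ on $(\mathcal{H}_0, \mathcal{H}_1)$.
   Context: $\mathcal{L}(\mathcal{H}_0,\mathcal{H}_1)$ is the space of bounded linear maps between Hilbert spaces $\mathcal{H}_0$ and $\mathcal{H}_1$, and $\mathcal{L}(\mathcal{H})=\mathcal{L}(\mathcal{H},\mathcal{H})$. A representation of a C*-algebra on $\mathcal{H}$ is a $*$-homomorphism into $\mathcal{L}(\mathcal{H})$. The $B$-valued inner product $\langle -,-\rangle_B$ of a right Hilbert $B$-module is linear in the second variable and conjugate linear in the first; the $A$-valued inner product ${}_A\langle -,-\rangle$ of a left Hilbert $A$-module is linear in the first variable and conjugate linear in the second. A Hilbert $A$-$B$-bimodule is a complex vector space $\mathsf{X}$ that is a left Hilbert $A$-module and a right Hilbert $B$-module such that ${}_A\langle x,y\rangle z = x\langle y,z\rangle_B$ for all $x,y,z\in\mathsf{X}$. A representation of a Hilbert $A$-$B$-bimodule $\mathsf{X}$ on a pair of Hilbert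 spaces $(\mathcal{H}_0,\mathcal{H}_1)$ is a triple $(\lambda_A,\rho_B,\pi_{\mathsf{X}})$ where $\lambda_A$ is a representation of $A$ on $\mathcal{H}_1$, $\rho_B$ is a representation of $B$ on $\mathcal{H}_0$, and $\pi_{\mathsf{X}}\colon\mathsf{X}\to\mathcal{L}(\mathcal{H}_0,\mathcal{H}_1)$ is a linear map such that for all $a\in A$, $b\in B$, $x,y\in\mathsf{X}$: (1) $\pi_{\mathsf{X}}(ax)=\lambda_A(a)\pi_{\mathsf{X}}(x)$; (2) $\pi_{\mathsf{X}}(xb)=\pi_{\mathsf{X}}(x)\rho_B(b)$; (3) $\lambda_A({}_A\langle x,y\rangle)=\pi_{\mathsf{X}}(x)\pi_{\mathsf{X}}(y)^*$; (4) $\rho_B(\langle x,y\rangle_B)=\pi_{\mathsf{X}}(x)^*\pi_{\mathsf{X}}(y)$. *)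

(* Defs.v *)
From HB Require Import structures.
From mathcomp Require Import all_boot all_order all_algebra.
From mathcomp Require Import all_classical all_reals all_analysis.
From mathcomp Require Import complex ring lra.

Set Implicit Arguments.
Unset Strict Implicit.
Unset Printing Implicit Defensive.

Import Order.TTheory GRing.Theory Num.Theory.
Import numFieldNormedType.Exports.

Local Open Scope classical_set_scope.
Local Open Scope ring_scope.

Local Notation "r %:C" := (real_complex _ r) (at level 1, format "r %:C").

(* The inner product is linear in its second variable.  The norm of the       *)
(* underlying complete normed module has values in R[i]; [hdot_norm] makes it *)
(* the norm of the inner product, which forces positive definiteness.         *)
HB.mixin Record CompleteNormedModule_isHilbert (R : realType) H
    of CompleteNormedModule R[i] H := {
  hdot : H -> H -> R[i] ;
  hdotDr : forall x, {morph hdot x : y z / y + z} ;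
  hdotZr : forall x c y, hdot x (c *: y) = c * hdot x y ;
  hdotC : forall x y, (hdot x y)^* = hdot y x ;
  hdot_norm : forall x, hdot x x = `|x| ^+ 2
}.

#[short(type="hilbertType")]
HB.structure Definition Hilbert (R : realType) :=
  {H of CompleteNormedModule R[i] H & CompleteNormedModule_isHilbert R H}.

(* No unit is assumed, hence the product cannot be that of a library ring. *)
HB.mixin Record CompleteNormedModule_isCStarAlgebra (R : realType) A
    of CompleteNormedModule R[i] A := {
  cmul : A -> A -> A ;
  cstar : A -> A ;
  cmulA : associative cmul ;
  cmulDl : left_distributive cmul +%R ;
  cmulDr : right_distributive cmul +%R ;
  cmulZl : forall c a b, cmul (c *: a) b = c *: cmul a b ;
  cmulZr : forall c a b, cmul a (c *: b) = c *: cmul a b ;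
  cstarK : involutive cstar ;
  cstarD : {morph cstar : a b / a + b} ;
  cstarZ : forall c a, cstar (c *: a) = c^* *: cstar a ;
  cstarM : forall a b, cstar (cmul a b) = cmul (cstar b) (cstar a) ;
  cnormM : forall a b, `|cmul a b| <= `|a| * `|b| ;
  cnorm_star : forall a, `|cmul (cstar a) a| = `|a| ^+ 2
}.

#[short(type="cstarAlgType")]
HB.structure Definition CStarAlgebra (R : realType) :=
  {A of CompleteNormedModule R[i] A & CompleteNormedModule_isCStarAlgebra R A}.

Definition cpositive (R : realType) (A : cstarAlgType R) (a : A) : Prop :=
  exists b : A, a = cmul (cstar b) b.

(* Completeness for a norm that is not the one of a [normedModType]: a        *)
(* Hilbert bimodule carries two inner products, each with its own norm.       *)
Definition norm_complete (R : realType) (V : zmodType) (N : V -> R[i]) : Prop :=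
  forall u : nat -> V,
    (forall e : R[i], 0 < e -> exists n0, forall m n,
       (n0 <= m)%N -> (n0 <= n)%N -> N (u m - u n) < e) ->
    exists l, forall e : R[i], 0 < e -> exists n0, forall n,
      (n0 <= n)%N -> N (u n - l) < e.

HB.mixin Record Lmodule_isRightHilbert (R : realType) (B : cstarAlgType R) X
    of GRing.Lmodule R[i] X := {
  ract : X -> B -> X ;
  rdot : X -> X -> B ;
  ractA : forall x b b', ract (ract x b) b' = ract x (cmul b b') ;
  ractDl : forall b, {morph ract^~ b : x y / x + y} ;
  ractDr : forall x, {morph ract x : b b' / b + b'} ;
  ractZl : forall c x b, ract (c *: x) b = c *: ract x b ;
  ractZr : forall c x b, ract x (c *: b) = c *: ract x b ;
  rdotDr : forall x, {morph rdot x : y z / y + z} ;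
  rdotZr : forall x c y, rdot x (c *: y) = c *: rdot x y ;
  rdotMr : forall x y b, rdot x (ract y b) = cmul (rdot x y) b ;
  rdot_star : forall x y, cstar (rdot x y) = rdot y x ;
  rdot_ge0 : forall x, cpositive (rdot x x) ;
  rdot_eq0 : forall x, rdot x x = 0 -> x = 0 ;
  rcomplete : norm_complete (fun x => sqrtC `|rdot x x|)
}.

#[short(type="rightHilbertType")]
HB.structure Definition RightHilbert (R : realType) (B : cstarAlgType R) :=
  {X of GRing.Lmodule R[i] X & Lmodule_isRightHilbert R B X}.

HB.mixin Record Lmodule_isLeftHilbert (R : realType) (A : cstarAlgType R) X
    of GRing.Lmodule R[i] X := {
  lact : A -> X -> X ;
  ldot : X -> X -> A ;
  lactA : forall a a' x, lact a (lact a' x) = lact (cmul a a') x ;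
  lactDl : forall x, {morph lact^~ x : a a' / a + a'} ;
  lactDr : forall a, {morph lact a : x y / x + y} ;
  lactZl : forall c a x, lact (c *: a) x = c *: lact a x ;
  lactZr : forall c a x, lact a (c *: x) = c *: lact a x ;
  ldotDl : forall y, {morph ldot^~ y : x z / x + z} ;
  ldotZl : forall c x y, ldot (c *: x) y = c *: ldot x y ;
  ldotMl : forall a x y, ldot (lact a x) y = cmul a (ldot x y) ;
  ldot_star : forall x y, cstar (ldot x y) = ldot y x ;
  ldot_ge0 : forall x, cpositive (ldot x x) ;
  ldot_eq0 : forall x, ldot x x = 0 -> x = 0 ;
  lcomplete : norm_complete (fun x => sqrtC `|ldot x x|)
}.

#[short(type="leftHilbertType")]
HB.structure Definition LeftHilbert (R : realType) (A : cstarAlgType R) :=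
  {X of GRing.Lmodule R[i] X & Lmodule_isLeftHilbert R A X}.

HB.mixin Record LeftRight_isHilbertBimodule (R : realType)
    (A B : cstarAlgType R) X of LeftHilbert R A X & RightHilbert R B X := {
  ldot_rdot : forall x y z : X,
    lact (ldot x y : A) z = ract x (rdot y z : B)
}.

#[short(type="hilbertBimodType")]
HB.structure Definition HilbertBimodule (R : realType) (A B : cstarAlgType R) :=
  {X of LeftHilbert R A X & RightHilbert R B X &
        LeftRight_isHilbertBimodule R A B X}.

(* On a Hilbert bimodule this agrees with the norm of the left module, as a   *)
(* consequence of [ldot_rdot] and the C*-identity.                             *)
Definition rnorm (R : realType) (B : cstarAlgType R) (X : rightHilbertType B)
  (x : X) : R[i] := sqrtC `|rdot x x : B|.

Section blin.
Context {R : realType}.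

Section def.
Variables V W : normedModType R[i].

Definition blinear_set : set (V -> W) := [set f |
  (forall c x y, f (c *: x + y) = c *: f x + f y) /\
  exists M : R, forall x, `|f x| <= M%:C * `|x|].

Definition blinear : {pred V -> W} := mem blinear_set.

Lemma blinearP (f : V -> W) : reflect (blinear_set f) (f \in blinear).
Proof. by apply: (iffP idP); rewrite !inE. Qed.

Record blin := Blin { blin_fun :> V -> W ; _ : blin_fun \in blinear }.

HB.instance Definition _ := [isSub of blin for blin_fun].
HB.instance Definition _ := [Choice of blin by <:].

Lemma blinear_submod_closed : submod_closed blinear.
Proof.
split=> [|c f g /blinearP[fl [M fM]] /blinearP[gl [N gN]]]; apply/blinearP.
  split=> [c x y|]; first by rewrite scaler0 addr0.
  by exists 0 => x; rewrite normr0 mul0r.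
split=> [d x y|].
  rewrite /= -[LHS]/(c *: f (d *: x + y) + g (d *: x + y)).
  rewrite -[RHS]/(d *: (c *: f x + g x) + (c *: f y + g y)).
  rewrite fl gl !scalerDr !scalerA (mulrC c d) addrACA //.
exists (complex.Re `|c| * M + N) => x.
have -> : (complex.Re `|c| * M + N)%:C = `|c| * M%:C + N%:C :> R[i].
  by rewrite rmorphD rmorphM /= (RRe_real (normr_real c)).
rewrite -[X in `|X|]/(c *: f x + g x) mulrDl.
rewrite (le_trans (ler_normD _ _))// lerD// normrZ -mulrA ler_wpM2l//.
Qed.

HB.instance Definition _ :=
  GRing.isSubmodClosed.Build _ _ blinear blinear_submod_closed.
HB.instance Definition _ := [SubChoice_isSubLmodule of blin by <:].

Lemma blin_linear (T : blin) c x y : T (c *: x + y) = c *: T x + T y.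
Proof. by case: T => f /= /blinearP[]. Qed.

HB.instance Definition _ (T : blin) :=
  GRing.isLinear.Build _ _ _ _ T (blin_linear T).

Lemma blin_bounded (T : blin) : exists M : R, forall x, `|T x| <= M%:C * `|x|.
Proof. by case: T => f /= /blinearP[]. Qed.

Definition opnorm (T : blin) : R[i] :=
  (inf [set M : R | 0 <= M /\ forall x, `|T x| <= M%:C * `|x|])%:C.

Lemma le_opnorm (T : blin) x : `|T x| <= opnorm T * `|x|.
Proof.
have [->|x0] := eqVneq x 0; first by rewrite linear0 !normr0 mulr0.
have nx0 : 0 < `|x| by rewrite normr_gt0.
rewrite -ler_pdivrMr// /opnorm.
have qr : `|T x| / `|x| = (complex.Re (`|T x| / `|x|))%:C.
  by rewrite RRe_real// ger0_real// divr_ge0.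
rewrite qr lecR; apply: lb_le_inf.
  have [M TM] := blin_bounded T; exists `|M|; split=> // y.
  by apply: (le_trans (TM y)); rewrite ler_wpM2r// lecR ler_norm.
by move=> M [_ TM]; rewrite -lecR -qr ler_pdivrMr.
Qed.

Lemma opnorm_le (T : blin) (M : R) : 0 <= M ->
  (forall x, `|T x| <= M%:C * `|x|) -> opnorm T <= M%:C.
Proof.
by move=> M0 TM; rewrite lecR; apply: ge_inf => //; exists 0 => ? [].
Qed.

End def.
Arguments blinear {V W}.

Lemma blin_ext (V W : normedModType R[i]) (S T : blin V W) :
  (forall x, S x = T x) -> S = T.
Proof. by move=> ST; apply/val_inj/funext. Qed.

Lemma blin_comp_subproof (U V W : normedModType R[i])
  (S : blin V W) (T : blin U V) : (S \o T : U -> W) \in blinear.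
Proof.
apply/blinearP; split=> [c x y|]; first by rewrite /= !linearP.
have [M SM] := blin_bounded S; have [N TN] := blin_bounded T.
exists (`|M| * N) => x; rewrite rmorphM/= -mulrA.
apply: (le_trans (SM _)); apply: (@le_trans _ _ (`|M|%:C * `|T x|)).
  by rewrite ler_wpM2r// lecR ler_norm.
by rewrite ler_wpM2l// lecR.
Qed.

Definition blin_comp (U V W : normedModType R[i])
  (S : blin V W) (T : blin U V) : blin U W := Blin (blin_comp_subproof S T).

End blin.
Arguments blinear {R V W}.

Local Notation "S \oB T" := (blin_comp S T) (at level 50, left associativity).

Section hilbert_theory.
Variables (R : realType) (H : hilbertType R).
Implicit Types (x y z : H) (c : R[i]).

Lemma hdotDl x y z : hdot (x + y) z = hdot x z + hdot y z.
Proof. by rewrite -(hdotC z (x + y)) hdotDr rmorphD/= !hdotC. Qed.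

Lemma hdotZl c x y : hdot (c *: x) y = c^* * hdot x y.
Proof. by rewrite -hdotC hdotZr rmorphM/= hdotC. Qed.

Lemma hdotNr x y : hdot x (- y) = - hdot x y.
Proof. by rewrite -scaleN1r hdotZr mulN1r. Qed.

Lemma hdotNl x y : hdot (- x) y = - hdot x y.
Proof. by rewrite -(hdotC y) hdotNr rmorphN/= hdotC. Qed.

Lemma hdot0r x : hdot x 0 = 0.
Proof. by rewrite -(scale0r 0) hdotZr mul0r. Qed.

Lemma hdot0l x : hdot 0 x = 0.
Proof. by rewrite -(hdotC x) hdot0r rmorph0. Qed.

Lemma hdot_inj x y : (forall z, hdot x z = hdot y z) -> x = y.
Proof.
move=> xy; apply/eqP; rewrite -subr_eq0 -normr_eq0 -sqrf_eq0 -hdot_norm.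
by rewrite hdotDl hdotNl xy subrr.
Qed.

Lemma cauchy_schwarz x y : `|hdot x y| <= `|x| * `|y|.
Proof.
have [->|y0] := eqVneq y 0; first by rewrite hdot0r !normr0 mulr0.
have ny0 : 0 < `|y| by rewrite normr_gt0.
rewrite -(@ler_pXn2r _ 2) ?nnegrE ?mulr_ge0// exprMn normCK hdotC.
have := exprn_ge0 2 (normr_ge0 (`|y| ^+ 2 *: x - hdot y x *: y)).
rewrite -hdot_norm !(hdotDl, hdotDr, hdotNl, hdotNr, hdotZl, hdotZr) !hdot_norm.
rewrite hdotC rmorphXn/= (conj_Creal (normr_real y)).
set a := hdot x y; set b := hdot y x; set p := `|x|; set q := `|y|.
rewrite (_ : _ + _ = q ^+ 2 * (p ^+ 2 * q ^+ 2 - a * b)); last by ring.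
by rewrite pmulr_rge0 ?exprn_gt0// subr_ge0.
Qed.

Let nr x : R := complex.Re `|x|.
Let re x y : R := complex.Re (hdot x y).

Let nrE x : `|x| = (nr x)%:C.
Proof. by rewrite /nr RRe_real// normr_real. Qed.

Let nr_ge0 x : 0 <= nr x.
Proof. by rewrite -lecR -nrE normr_ge0. Qed.

Let ReD (a b : R[i]) : complex.Re (a + b) = complex.Re a + complex.Re b.
Proof. by case: a; case: b. Qed.

Let ReZ (t : R) (b : R[i]) : complex.Re (t%:C * b) = t * complex.Re b.
Proof. by case: b => b1 b2 /=; rewrite mul0r subr0. Qed.

Let Re_le_norm (a : R[i]) : `|complex.Re a| <= complex.Re `|a|.
Proof.
rewrite normc_def/= -sqrtr_sqr ler_wsqrtr// lerDl sqr_ge0 //.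
Qed.

Let le_norm x y : `|re x y| <= nr x * nr y.
Proof.
apply: (le_trans (Re_le_norm _)).
have := cauchy_schwarz x y.
by rewrite !nrE -rmorphM/= lecE => /andP[].
Qed.

Let nrD x y : nr (x + y) ^+ 2 = nr x ^+ 2 + nr y ^+ 2 + 2 * re x y.
Proof.
have e z : nr z ^+ 2 = re z z by rewrite /re hdot_norm nrE -rmorphXn.
rewrite !e /re hdotDl !hdotDr !ReD -(hdotC x y).
have -> : complex.Re (hdot x y)^* = complex.Re (hdot x y) by case: (hdot x y).
ring.
Qed.

Let nrZ (t : R) x : nr (t%:C *: x) ^+ 2 = t ^+ 2 * nr x ^+ 2.
Proof.
have e z : nr z ^+ 2 = re z z by rewrite /re hdot_norm nrE -rmorphXn.
rewrite !e /re hdotZl hdotZr.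
have -> : t%:C^* = t%:C by apply: conj_Creal; rewrite complex_real.
by rewrite !ReZ mulrA.
Qed.

Let reZ (t : R) x y : re x (t%:C *: y) = t * re x y.
Proof. by rewrite /re hdotZr ReZ. Qed.

Lemma riesz (f : H -> R[i]) (M : R) :
  (forall c x y, f (c *: x + y) = c * f x + f y) ->
  (forall x, `|f x| <= M%:C * `|x|) -> exists z, forall x, f x = hdot z x.
Proof.
move=> fl fM.
have f0 : f 0 = 0 by have /eqP := fl 1 0 0; rewrite scaler0 addr0 mul1r addrC -subr_eq subrr => /eqP.
have fD x y : f (x + y) = f x + f y by rewrite -(scale1r x) fl mul1r scale1r.
have fZ c x : f (c *: x) = c * f x by rewrite -[c *: x]addr0 fl f0 addr0.
pose g x : R := complex.Re (f x).
have gM x : `|g x| <= M * nr x.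
  by apply: (le_trans (Re_le_norm _)); have := fM x; rewrite nrE -rmorphM/= lecE => /andP[].
pose q x : R := nr x ^+ 2 - 2 * g x.
have q_lb x : - M ^+ 2 <= q x.
  rewrite /q; have := gM x; rewrite ler_norml => /andP[_ h].
  by have := sqr_ge0 (nr x - M); nra.
have qinf : has_inf (range q).
  split; first by exists (q 0), 0.
  by exists (- M ^+ 2) => _ [x _ <-].
pose d := inf (range q).
have dq x : d <= q x by apply: ge_inf; [case: qinf | exists x].
have /choice[u uP] : forall n, exists x, q x < d + n.+1%:R^-1.
  move=> n; have n0 : 0 < n.+1%:R^-1 :> R by rewrite invr_gt0.
  by have [_ [x _ <-]] := inf_adherent n0 qinf; exists x.
have qpar x y : nr (x - y) ^+ 2 <= 2 * (q x - d) + 2 * (q y - d).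
  have e : x - y = x + (-1)%:C *: y by rewrite rmorphN1 scaleN1r.
  pose h : R := 2^-1; have h2 : h * 2 = 1 by rewrite mulVf.
  have := dq (h%:C *: (x + y)).
  rewrite /q nrZ e !nrD nrZ reZ /g fZ ReZ fD ReD.
  rewrite (_ : h ^+ 2 = h / 2); last by rewrite expr2.
  move: (complex.Re (f x)) (complex.Re (f y)) (nr x ^+ 2) (nr y ^+ 2) (re x y).
  by move=> a b p q' r; rewrite /h => hh; lra.
have ucauchy (e : R) : 0 < e -> exists N, forall m n, (N <= m)%N -> (N <= n)%N ->
    nr (u m - u n) < e.
  move=> e0; have e20 : 0 < e ^+ 2 / 4 by rewrite divr_gt0 ?exprn_gt0.
  have [N] := near_infty_natSinv_lt (PosNum e20); move=> _ /= NP.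
  exists N => m n Nm Nn.
  rewrite -(@ltr_pXn2r _ 2) ?nnegrE ?(ltW e0)//.
  apply: (le_lt_trans (qpar _ _)).
  have um := lt_le_trans (uP m) (ltW (ler_ltD (lexx d) (NP _ Nm))).
  have un := lt_le_trans (uP n) (ltW (ler_ltD (lexx d) (NP _ Nn))).
  move: um un => /=; move: (q (u m)) (q (u n)) (e ^+ 2) => a b c; lra.
have /cvg_ex[z /= uz] : cvg (u @ \oo).
  apply: cauchy_cvg; apply: cauchy_exP => e e0.
  have ereal : e = (complex.Re e)%:C by rewrite RRe_real// gtr0_real.
  have e0' : 0 < complex.Re e by rewrite -ltcR -ereal.
  have [N NP] := ucauchy _ e0'.
  exists (u N); exists N => // n /= Nn.
  by rewrite -ball_normE /ball_/= nrE ereal ltcR; apply: NP.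
have main v (t e : R) : 0 < e ->
    0 <= t ^+ 2 * nr v ^+ 2 + 2 * t * (re z v - g v) + (2 * `|t| * nr v + 1) * e.
  move=> e0.
  have eC0 : 0 < e%:C by rewrite ltcR.
  have [N1 _ N1P] := near_infty_natSinv_lt (PosNum e0).
  have [N2 _ N2P] := (@cvgrPdist_lt _ _ _ _ _ _ _).1 uz _ eC0.
  pose n := maxn N1 N2.
  have /= n1 := N1P n (leq_maxl _ _).
  have /= := N2P n (leq_maxr _ _); rewrite nrE ltcR => n2.
  have := uP n; have := dq (u n + t%:C *: v).
  rewrite /q nrD nrZ reZ /g fD ReD fZ ReZ -/(g _) -/(g _).
  have := le_norm (z - u n) v.
  have -> : re (z - u n) v = re z v - re (u n) v.
    by rewrite /re hdotDl hdotNl; case: (hdot z v) => ? ?; case: (hdot (u n) v).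
  have := nr_ge0 v; have := nr_ge0 (z - u n).
  move: (nr (z - u n)) n2 (nr v) (nr (u n) ^+ 2) (re z v) (re (u n) v) (g v) (g (u n)).
  move=> a ae p s r1 r2 gv gu a0 p0 rr h1 h2.
  have h3 : t * (r2 - r1) <= `|t| * (e * p).
    apply: (le_trans (ler_norm _)); rewrite normrM ler_wpM2l// distrC.
    by apply: (le_trans rr); rewrite ler_wpM2r// ltW.
  have h4 : s - 2 * gu < d + e by apply: (lt_trans h2); rewrite ltrD2l.
  clear -h1 h3 h4; lra.
have rez v : g v = re z v.
  apply/eqP; rewrite eq_sym -subr_eq0; apply/eqP; apply: contrapT => /eqP D0.
  set D := re z v - g v in D0.
  pose P := nr v ^+ 2 + 1.
  have P0 : 0 < P by rewrite ltr_wpDl// sqr_ge0.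
  pose t : R := - D / P.
  have D2 : 0 < D ^+ 2 / P by rewrite divr_gt0// exprn_even_gt0.
  pose K := 2 * `|t| * nr v + 1.
  have K0 : 0 < K by rewrite ltr_wpDl// !mulr_ge0.
  have e0 : 0 < D ^+ 2 / P / 2 / K by apply: divr_gt0 => //; exact: divr_gt0.
  have := main v t _ e0; rewrite -/D -/K [K * _]mulrC divfK ?gt_eqF//.
  apply/negP; rewrite -ltNge.
  have tP : t * P = - D by rewrite /t divfK ?gt_eqF.
  have wE : D ^+ 2 / P = - (t * D) by rewrite /t mulNr mulNr opprK mulrAC.
  rewrite wE in D2 *.
  have t2 : t ^+ 2 * P = - (t * D) by rewrite expr2 -mulrA tP mulrN.
  have := sqr_ge0 t; move: t2; rewrite /P mulrDr mulr1 => t2 t20.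
  clear -D2 t2 t20; lra.
exists z => x.
have imE (a : R[i]) : complex.Im a = - complex.Re ('i%C * a).
  by case: a => a b /=; rewrite mul0r mul1r add0r opprK.
apply/eqP; rewrite eq_complex; apply/andP; split; apply/eqP; first exact: rez.
by rewrite !imE -fZ -hdotZr; congr (- _); exact: rez.
Qed.

End hilbert_theory.

Section adjoint.
Context {R : realType} {H K : hilbertType R}.

Lemma adjoint_exists (T : blin H K) :
  exists S : blin K H, forall x y, hdot (T x) y = hdot x (S y).
Proof.
have [M0 TM0] := blin_bounded T; pose M : R := `|M0|.
have TM x : `|T x| <= M%:C * `|x|.
  by apply: (le_trans (TM0 x)); rewrite ler_wpM2r// lecR ler_norm.
have MC0 : 0 <= M%:C by rewrite lecR /M normr_ge0.
have /choice[S SP] y : exists z, forall x, hdot y (T x) = hdot z x.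
  apply: (@riesz _ _ _ (complex.Re `|y| * M)) => [c x x'|x].
    by rewrite linearP hdotDr hdotZr.
  apply: (le_trans (cauchy_schwarz _ _)).
  rewrite rmorphM/= (RRe_real (normr_real y)) -mulrA.
  by rewrite ler_wpM2l.
have SE x y : hdot (T x) y = hdot x (S y) by rewrite -hdotC SP hdotC.
have Sin : (S : K -> H) \in blinear.
  apply/blinearP; split=> [c x y|].
    apply: hdot_inj => z.
    by rewrite hdotDl hdotZl -!SP hdotDl hdotZl.
  exists M => y.
  have [->|S0] := eqVneq (S y) 0; first by rewrite normr0 mulr_ge0.
  have nS0 : 0 < `|S y| by rewrite normr_gt0.
  rewrite -(ler_pM2r nS0) -expr2 -hdot_norm -SE.
  have := cauchy_schwarz (T (S y)) y.
  have := TM (S y).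
  move=> h1 h2.
  have e : hdot (T (S y)) y = `|hdot (T (S y)) y|.
    by rewrite SE hdot_norm ger0_norm// exprn_ge0.
  rewrite e; apply: (le_trans h2); rewrite mulrAC.
  by rewrite ler_wpM2r.
by exists (Blin Sin).
Qed.

Definition adjoint (T : blin H K) : blin K H := projT1 (cid (adjoint_exists T)).

Lemma adjointP (T : blin H K) x y : hdot (T x) y = hdot x (adjoint T y).
Proof. by rewrite /adjoint; case: cid => S /=. Qed.

Lemma adjoint_eq (T : blin H K) (S : blin K H) :
  (forall x y, hdot (T x) y = hdot x (S y)) -> adjoint T = S.
Proof.
move=> TS; apply: blin_ext => y; apply: hdot_inj => x.
by rewrite -hdotC -adjointP TS hdotC.
Qed.

End adjoint.

Record star_rep (R : realType) (A : cstarAlgType R) (H : hilbertType R) := {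
  star_rep_fun :> {linear A -> blin H H} ;
  star_repM : forall a b,
    star_rep_fun (cmul a b) = star_rep_fun a \oB star_rep_fun b ;
  star_rep_star : forall a, star_rep_fun (cstar a) = adjoint (star_rep_fun a)
}.

Definition linear_span (K : pzRingType) (V : lmodType K) (S : set V) : set V :=
  [set v | exists n (c : 'I_n -> K) (w : 'I_n -> V),
    (forall i, S (w i)) /\ v = \sum_(i < n) c i *: w i].

Definition nondegenerate_rep (R : realType) (A : cstarAlgType R)
    (H : hilbertType R) (l : star_rep A H) : Prop :=
  closure (linear_span [set v : H | exists a h, v = l a h]) = setT.

Definition bounded_on_module (R : realType) (B : cstarAlgType R)
    (X : rightHilbertType B) (V W : normedModType R[i]) (p : X -> blin V W) :
    Prop :=
  exists M : R, forall x, opnorm (p x) <= M%:C * rnorm x.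

Record bimodule_rep (R : realType) (A B : cstarAlgType R)
    (X : hilbertBimodType A B) (H0 H1 : hilbertType R)
    (l : star_rep A H1) (r : star_rep B H0) (p : {linear X -> blin H0 H1}) :
    Prop := {
  bimodule_rep_lact : forall (a : A) x, p (lact a x) = l a \oB p x ;
  bimodule_rep_ract : forall (b : B) x, p (ract x b) = p x \oB r b ;
  bimodule_rep_ldot : forall x y, l (ldot x y) = p x \oB adjoint (p y) ;
  bimodule_rep_rdot : forall x y, r (rdot x y) = adjoint (p x) \oB p y
}.

(* Main.v *)
From HB Require Import structures.
Require Import Defs.
From mathcomp Require Import all_boot all_order all_algebra.
From mathcomp Require Import all_classical all_reals all_analysis.
From mathcomp Require Import complex ring lra.

Set Implicit Arguments.
Unset Strict Implicit.
Unset Printing Implicit Defensive.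

Import Order.TTheory GRing.Theory Num.Theory.
Import numFieldNormedType.Exports.

Local Open Scope classical_set_scope.
Local Open Scope ring_scope.

Local Notation "r %:C" := (real_complex _ r) (at level 1, format "r %:C").

(** The space carrying the representation of [A] is the interior tensor product
    of [X] with [H0] over [B]: the completion of the span of the simple tensors
    [x (x) h] for the inner product
      [<x (x) h, y (x) k> = <h, rho <x, y> k>].
    The algebra [A] acts by [a (x (x) h) = a x (x) h], and [pi x] sends [h] to
    [x (x) h]. Granted that this makes sense, the axioms of a representation
    are read off on simple tensors; the one for the left inner product uses
    that [<x, y> z] equals [x <y, z>].

    Four points need an argument.

    - Positivity of the inner product ([gram_ge0]). If all vectors are
      [h_i = rho b_i h] for one [h], the sum of the [x_i (x) h_i] is the simple
      tensor of [x_1 b_1 + ... + x_n b_n] with [h], whose square norm is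
      nonnegative. The general case follows by induction, splitting the vectors
      along the closed invariant subspace generated by one of them
      ([hilbert_projection]); nondegeneracy says that a vector lies in the
      closed invariant subspace that it generates.

    - Boundedness of the actions ([act_norm_le]). If [b] is self-adjoint of
      norm less than 1, then [1 - b] is the square of a self-adjoint element
      [1 - d] ([cstar_sqrt]), so [<v, v> - <v, b v>] is the squared norm of
      [v - d v]. This uses the algebraic laws of an action only, and applies to
      [rho] as well as to the action of [A] on the uncompleted tensor product.

    - [A] acts by adjointable maps ([rdot_lact]). The identity
      [<a x, y> = <x, a^* y>] between elements of [B] is a consequence of the
      compatibility of the two inner products.

    - Completion ([completion]). A pre-Hilbert space [V] is mapped to its
      antilinear dual, and the completion is the closure of the image. A
      bounded operator on [V] with an adjoint extends by composing functionals
      with the adjoint.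

    Nondegeneracy of the representation of [A] holds since a vector [w]
    orthogonal to its range satisfies [pi x (pi x)^* w = 0] for all [x], hence
    is orthogonal to all simple tensors. *)

(** * Convergence at a prescribed rate *)

(** Working with an explicit rate instead of the topology lets the same
    statements serve complete modules over R[i] and R[i] itself. *)
Definition vanishing (K : numFieldType) (r : nat -> K) : Prop :=
  forall e : K, 0 < e -> exists N, forall n, (N <= n)%N -> r n < e.

Lemma eq0_of_vanishing (K : numFieldType) (r : nat -> K) (x c : K) :
  vanishing r -> 0 <= c -> 0 <= x -> (forall n, x <= c * r n) -> x = 0.
Proof.
move=> r0 c0 x0 xr; apply/eqP; rewrite eq_le x0 andbT.
apply/ler_addgt0Pr => e e0; rewrite add0r.
have c1 : 0 < c + 1 by rewrite ltr_wpDl.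
have [N NP] := r0 (e / (c + 1)) (divr_gt0 e0 c1).
have rN := ltW (NP N (leqnn N)).
apply: (le_trans (xr N)); apply: (le_trans (ler_wpM2l c0 rN)).
by rewrite mulrCA ler_piMr ?(ltW e0)// ler_pdivrMr// mul1r lerDl.
Qed.

Lemma le_of_vanishing (K : numFieldType) (r : nat -> K) (x y : K) :
  vanishing r -> (forall n, x <= y + r n) -> x <= y.
Proof.
move=> r0 xr; apply/ler_addgt0Pr => e e0.
have [N NP] := r0 e e0.
by apply: (le_trans (xr N)); rewrite lerD2l ltW// NP.
Qed.

Lemma vanishing_natSinv (R : realType) : vanishing (fun n => n.+1%:R^-1 : R).
Proof.
move=> e e0; have [N _ NP] := near_infty_natSinv_lt (PosNum e0).
by exists N => n /NP.
Qed.

Lemma vanishing_mul (R : realType) (r : nat -> R) (c : R) :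
  0 <= c -> vanishing r -> vanishing (fun n => c * r n).
Proof.
move=> c0 r0 e e0.
have c1 : 0 < c + 1 by rewrite ltr_wpDl.
have [N NP] := r0 (e / (c + 1)) (divr_gt0 e0 c1).
exists N => n Nn; have := ler_wpM2l c0 (ltW (NP n Nn)).
move=> /le_lt_trans; apply; rewrite mulrCA gtr_pMr// ltr_pdivrMr// mul1r.
by rewrite ltrDl.
Qed.

Lemma vanishing_complex (R : realType) (r : nat -> R) :
  vanishing r -> vanishing (fun n => (r n)%:C).
Proof.
move=> r0 e e0.
have eE : e = (complex.Re e)%:C by rewrite RRe_real// gtr0_real.
have e0' : 0 < complex.Re e by rewrite -ltcR -eE.
by have [N NP] := r0 _ e0'; exists N => n Nn; rewrite eE ltcR NP.
Qed.

Lemma complete_at_rate (K : numFieldType) (V : completeNormedModType K)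
    (u : nat -> V) (r : nat -> K) :
  (forall n, 0 <= r n) -> vanishing r ->
  (forall m n, `|u m - u n| <= r m + r n) ->
  exists l, forall n, `|u n - l| <= r n.
Proof.
move=> rge0 r0 ur.
have /cvg_ex[l /= ul] : cvg (u @ \oo).
  apply: cauchy_cvg; apply: cauchy_exP => e e0.
  have e20 : 0 < e / 2 by rewrite divr_gt0.
  have [N NP] := r0 _ e20; exists (u N); exists N => // n /= Nn.
  rewrite -ball_normE /ball_/=; apply: (le_lt_trans (ur _ _)).
  by rewrite [ltRHS](splitr e) ltrD// NP.
exists l => n; apply/ler_addgt0Pr => e e0.
have e20 : 0 < e / 2 by rewrite divr_gt0.
have [N NP] := r0 _ e20.
have [M _ MP] := (@cvgrPdist_lt _ _ _ _ _ _ _).1 ul _ e20.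
pose m := maxn N M.
have h1 := NP m (leq_maxl _ _); have /= h2 := MP m (leq_maxr _ _).
rewrite (_ : u n - l = (u n - u m) - (l - u m)); last first.
  by rewrite opprB addrA subrK.
apply: (le_trans (ler_normB _ _)); rewrite (splitr e) addrA lerD//;
  last exact: ltW.
by apply: (le_trans (ur _ _)); rewrite lerD2l ltW.
Qed.

Lemma normc_le_ReIm (R : realType) (z : R[i]) :
  `|z| <= (`|complex.Re z| + `|complex.Im z|)%:C.
Proof.
rewrite normc_def lecR -[leRHS]ger0_norm ?addr_ge0// -sqrtr_sqr.
rewrite ler_wsqrtr// sqrrD !real_normK ?num_real//.
rewrite -addrA lerD2l// lerDr mulrn_wge0// mulr_ge0 //.
Qed.

Lemma complex_complete_at_rate (R : realType) (z : nat -> R[i]) (r : nat -> R) :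
  (forall n, 0 <= r n) -> vanishing r ->
  (forall m n, `|z m - z n| <= (r m + r n)%:C) ->
  exists l, forall n, `|z n - l| <= (2 * r n)%:C.
Proof.
move=> rge0 r0 zr.
have part (f : R[i] -> R) : {morph f : x y / x - y} ->
    (forall x, `|f x|%:C <= `|x|) ->
    exists l, forall n, `|f (z n) - l| <= r n.
  move=> fB fn; apply: (@complete_at_rate R R^o) => // m n.
  by rewrite -fB -lecR; apply: (le_trans (fn _)).
have [||a aP] := part (@complex.Re R); first by case=> ? ? [].
  exact: normc_ge_Re.
have [||b bP] := part (@complex.Im R); first by case=> ? ? [].
  by move=> x; rewrite normc_def lecR -sqrtr_sqr ler_wsqrtr// lerDr sqr_ge0.
exists (Complex a b) => n; apply: (le_trans (normc_le_ReIm _)).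
rewrite lecR mulr2n mulrDl mul1r lerD//.
  by move: (aP n); case: (z n).
by move: (bP n); case: (z n).
Qed.

(** As R[i] is only partially ordered, the positivity of the limit is read off
    the equation [x = `|x|]. *)
Lemma ge0_of_vanishing (R : realType) (z : nat -> R[i]) (r : nat -> R)
    (x c : R[i]) :
  vanishing r -> 0 <= c -> (forall n, 0 <= z n) ->
  (forall n, `|x - z n| <= c * (r n)%:C) -> 0 <= x.
Proof.
move=> r0 c0 z0 xz; suff -> : x = `|x| by [].
apply/eqP; rewrite -subr_eq0 -normr_eq0; apply/eqP.
apply: (@eq0_of_vanishing _ _ _ (2 * c) (vanishing_complex r0)) => [||n] //.
  by rewrite mulr_ge0.
rewrite (_ : x - _ = (x - z n) + (z n - `|x|)); last by rewrite addrA subrK.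
apply: (le_trans (ler_normD _ _)).
rewrite -mulrA mulr_natl mulr2n; apply: lerD => //.
rewrite -{1}(ger0_norm (z0 n)); apply: (le_trans (ler_dist_dist _ _)).
by rewrite distrC.
Qed.

(** * Positive semidefinite inner products *)

Record semi_inner (R : realType) (V : lmodType R[i]) := SemiInner {
  sdot :> V -> V -> R[i] ;
  sdotDr : forall x y z, sdot x (y + z) = sdot x y + sdot x z ;
  sdotZr : forall c x y, sdot x (c *: y) = c * sdot x y ;
  sdotC : forall x y, (sdot x y)^* = sdot y x ;
  sdot_ge0 : forall x, 0 <= sdot x x
}.

Definition hilbert_semi_inner (R : realType) (H : hilbertType R) :
  semi_inner H.
Proof.
by exists (@hdot R H); [exact: hdotDr | move=> *; exact: hdotZr | exact: hdotC |
  move=> x; rewrite hdot_norm exprn_ge0].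
Defined.

Section semi_inner_theory.
Variables (R : realType) (V : lmodType R[i]) (s : semi_inner V).
Implicit Types (x y z : V) (c : R[i]).

Lemma sdotDl x y z : s (x + y) z = s x z + s y z.
Proof. by rewrite -(sdotC s z) sdotDr rmorphD/= !sdotC. Qed.

Lemma sdotZl c x y : s (c *: x) y = c^* * s x y.
Proof. by rewrite -sdotC sdotZr rmorphM/= sdotC. Qed.

Lemma sdot0r x : s x 0 = 0.
Proof. by rewrite -(scale0r (0 : V)) sdotZr mul0r. Qed.

Lemma sdotNr x y : s x (- y) = - s x y.
Proof. by rewrite -scaleN1r sdotZr mulN1r. Qed.

Lemma sdotNl x y : s (- x) y = - s x y.
Proof. by rewrite -(sdotC s y) sdotNr rmorphN/= sdotC. Qed.

(** A real number, unlike the norm of a normed module over R[i]. *)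
Definition snorm x : R := Num.sqrt (complex.Re (s x x)).

Lemma snorm_ge0 x : 0 <= snorm x.
Proof. exact: sqrtr_ge0. Qed.

Lemma snormC_ge0 x : 0 <= (snorm x)%:C.
Proof. by rewrite ler0c snorm_ge0. Qed.

Lemma snorm_sqr x : (snorm x)%:C ^+ 2 = s x x.
Proof.
rewrite -rmorphXn /=.
have sr : (complex.Re (s x x))%:C = s x x.
  by rewrite RRe_real// ger0_real// sdot_ge0.
by rewrite sqr_sqrtr// -ler0c sr sdot_ge0.
Qed.

(** The expansions at [s y y *: x - s y x *: y] and at its mirror image give
    the inequality unless both squared norms vanish; the last case needs
    [x - s y x *: y]. *)
Lemma sdot_cauchy_schwarz x y : `|s x y| <= (snorm x * snorm y)%:C.
Proof.
suff h : `|s x y| ^+ 2 <= s x x * s y y.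
  rewrite rmorphM/= -(@ler_pXn2r _ 2) ?nnegrE ?mulr_ge0 ?snormC_ge0//.
  by rewrite exprMn !snorm_sqr.
have pos (u v : V) : 0 < s v v -> `|s u v| ^+ 2 <= s u u * s v v.
  move=> v0; have := sdot_ge0 s (s v v *: u - s v u *: v).
  rewrite !(sdotDl, sdotDr, sdotNl, sdotNr, sdotZl, sdotZr) !sdotC normCK sdotC.
  set a := s u v; set b := s v u; set p := s u u; set q := s v v.
  rewrite (_ : _ + _ = q * (p * q - a * b)); last by ring.
  by rewrite pmulr_rge0// subr_ge0.
have := sdot_ge0 s y; rewrite le_eqVlt => /predU1P[y0|]; last exact: pos.
have := sdot_ge0 s x; rewrite le_eqVlt => /predU1P[x0|]; last first.
  by move=> /(pos y); rewrite -(sdotC s x) norm_conjC mulrC.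
have := sdot_ge0 s (x - s y x *: y).
rewrite !(sdotDl, sdotDr, sdotNl, sdotNr, sdotZl, sdotZr) !sdotC normCK sdotC.
rewrite -y0 -x0; set a := s x y; set b := s y x.
rewrite (_ : _ + _ = - (a * b + a * b)); last by ring.
rewrite oppr_ge0 mul0r => h; apply: le_trans h; rewrite lerDl.
by rewrite /b -(sdotC s x) -normCK exprn_ge0.
Qed.

End semi_inner_theory.

Lemma hilbert_snorm (R : realType) (H : hilbertType R) (x : H) :
  (snorm (hilbert_semi_inner H) x)%:C = `|x|.
Proof.
apply/eqP; rewrite -(@eqrXn2 _ 2) ?snormC_ge0//.
by rewrite snorm_sqr /= hdot_norm.
Qed.

(** * Actions of a C*-algebra on a pre-Hilbert space are contractive *)

Section cstar_theory.
Variables (R : realType) (A : cstarAlgType R).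
Implicit Types (a b d : A).

Lemma cstarN a : cstar (- a) = - cstar a.
Proof. by rewrite -scaleN1r cstarZ rmorphN1 scaleN1r. Qed.

Lemma cmulNr a b : cmul a (- b) = - cmul a b.
Proof. by rewrite -scaleN1r cmulZr scaleN1r. Qed.

Lemma cmulNl a b : cmul (- a) b = - cmul a b.
Proof. by rewrite -scaleN1r cmulZl scaleN1r. Qed.

Lemma cstar_mul_eq0 a : cmul (cstar a) a = 0 -> a = 0.
Proof.
move=> h; apply/eqP; rewrite -normr_eq0 -sqrf_eq0 -cnorm_star h normr0 //.
Qed.

Lemma norm_cstar a : `|cstar a| = `|a|.
Proof.
have le b : `|b| <= `|cstar b|.
  have [->|b0] := eqVneq b 0; first by rewrite normr0.
  rewrite -(ler_pM2r (_ : 0 < `|b|)) ?normr_gt0// -expr2 -cnorm_star.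
  exact: cnormM.
by apply/eqP; rewrite eq_le le andbT -{2}(cstarK a) le.
Qed.

(** In the unitization, [1 - d] is a self-adjoint square root of [1 - a]. It
    is found without a unit, as the fixed point [d] of [d |-> (a + d^2) / 2],
    which is a contraction of the ball of radius the norm of [a]. *)
Lemma cstar_sqrt a : cstar a = a -> `|a| < 1 ->
  exists d, cstar d = d /\ d + d - cmul d d = a.
Proof.
move=> aa a1.
pose k : R := complex.Re `|a|.
have kE : `|a| = k%:C by rewrite RRe_real// normr_real.
have k0 : 0 <= k by rewrite -ler0c -kE.
have k1 : k < 1 by rewrite -ltcR -kE.
pose h : R[i] := 2^-1.
have h0 : 0 <= h by rewrite invr_ge0.
have hn : `|h| = h by rewrite ger0_norm.
have h2 : h + h = 1 by have := splitr (1 : R[i]); rewrite !mul1r.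
pose F d := h *: (a + cmul d d).
pose u n := iter n F 0.
have uS n : u n.+1 = F (u n) by [].
have un n : `|u n| <= `|a|.
  elim: n => [|n IH]; first by rewrite normr0.
  rewrite uS /F normrZ hn.
  have e : `|a| = h * (`|a| + `|a|) by rewrite mulrDr -mulrDl h2 mul1r.
  rewrite [leRHS]e ler_wpM2l//; apply: (le_trans (ler_normD _ _)).
  rewrite lerD2l; apply: (le_trans (cnormM _ _)).
  apply: (@le_trans _ _ (`|a| * `|a|)); first by rewrite ler_pM.
  by rewrite ler_piMl// ltW.
have FB d e : `|d| <= `|a| -> `|e| <= `|a| -> `|F d - F e| <= `|a| * `|d - e|.
  move=> da ea; rewrite /F -scalerBr normrZ hn opprD addrACA subrr add0r.
  have -> : cmul d d - cmul e e = cmul d (d - e) + cmul (d - e) e.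
    by rewrite cmulDr cmulDl cmulNr cmulNl addrA subrK.
  rewrite -[leRHS]mul1r -h2 mulrDl -mulrDr ler_wpM2l//.
  apply: (le_trans (ler_normD _ _)); apply: lerD.
    by apply: (le_trans (cnormM _ _)); rewrite ler_wpM2r.
  by apply: (le_trans (cnormM _ _)); rewrite mulrC ler_wpM2r.
have stepn n : `|u n.+1 - u n| <= (k ^+ n)%:C.
  elim: n => [|n IH].
    by rewrite /u /= subr0 expr0; apply: le_trans (un 1) (ltW a1).
  rewrite [u n.+2]uS {2}[u n.+1]uS; apply: (le_trans (FB _ _ (un _) (un _))).
  by rewrite exprS rmorphM/= -kE ler_wpM2l.
have k1' : 0 < 1 - k by rewrite subr_gt0.
pose r n := (k ^+ n / (1 - k)).
have r_ge0 n : 0 <= r n by rewrite divr_ge0 ?exprn_ge0// ltW.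
have diff n j : `|u (n + j)%N - u n| <= (r n - r (n + j)%N)%:C.
  elim: j => [|j IH]; first by rewrite addn0 !subrr normr0.
  rewrite -(subrK (u (n + j)%N) (u _)) -addrA;
    apply: (le_trans (ler_normD _ _)).
  have e : r n - r (n + j.+1)%N = k ^+ (n + j)%N + (r n - r (n + j)%N).
    rewrite /r addnS exprS; field; exact: lt0r_neq0.
  by rewrite e rmorphD/= lerD// addnS.
have r0 : vanishing r.
  move=> e e0.
  have kc : (fun n => k ^+ n) @ \oo --> 0 by apply: cvg_expr; rewrite ger0_norm.
  have e1 : 0 < e * (1 - k) by rewrite mulr_gt0.
  have [N _ NP] := (@cvgrPdist_lt _ _ _ _ _ _ _).1 kc _ e1.
  exists N => n /NP /=; rewrite sub0r normrN ger0_norm ?exprn_ge0// => kn.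
  by rewrite /r ltr_pdivrMr.
have [d dP] : exists d, forall n, `|u n - d| <= (r n)%:C.
  apply: complete_at_rate => [n||m n]; first by rewrite ler0c.
    exact: vanishing_complex.
  have lem i j : (i <= j)%N -> `|u j - u i| <= (r i)%:C + (r j)%:C.
    move=> ij; rewrite -(subnKC ij); apply: (le_trans (diff _ _)).
    rewrite -rmorphD lecR lerD2l; apply: (@le_trans _ _ 0);
      first by rewrite oppr_le0.
    exact: r_ge0.
  case/orP: (leq_total m n) => mn; last by rewrite [leRHS]addrC lem.
  by rewrite distrC lem.
have rC0 := vanishing_complex r0.
have da : `|d| <= `|a|.
  apply: (le_of_vanishing rC0) => n.
  rewrite -{1}(subrK (u n) d) addrC; apply: (le_trans (ler_normD _ _)).
  by rewrite lerD// distrC.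
exists d; split.
  apply/eqP; rewrite -subr_eq0 -normr_eq0; apply/eqP.
  apply: (@eq0_of_vanishing _ _ _ 2 rC0) => // n.
  have usa m : cstar (u m) = u m.
    elim: m => [|m IH];
      first by rewrite /u/= -(scale0r 0) cstarZ conjC0 !scale0r.
    by rewrite uS /F cstarZ cstarD cstarM IH aa conj_Creal// ger0_real.
  rewrite -(subrK (u n) (cstar d)) -addrA (le_trans (ler_normD _ _))//.
  rewrite mulr_natl mulr2n lerD// -{1}usa distrC -cstarN -cstarD norm_cstar//.
have dF : F d = d.
  apply/eqP; rewrite -subr_eq0 -normr_eq0; apply/eqP.
  apply: (@eq0_of_vanishing _ _ _ (k%:C + 1) rC0) => // [|n].
    by rewrite -[1]/(1%:C) -rmorphD ler0c addr_ge0.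
  have e : F d - d = (F d - F (u n)) + (u n.+1 - d) by rewrite uS addrA subrK.
  rewrite e; apply: (le_trans (ler_normD _ _)); rewrite mulrDl lerD//.
    apply: (le_trans (FB _ _ da (un _))); rewrite kE ler_wpM2l ?ler0c//.
    by rewrite distrC.
  rewrite mul1r; apply: (le_trans (dP _)); rewrite lecR.
  by rewrite ler_wpM2r ?invr_ge0 ?(ltW k1')// exprS ler_piMl ?exprn_ge0// ltW.
rewrite -{1 2}dF /F -scalerDl h2 scale1r addrK //.
Qed.

End cstar_theory.

(** Continuity is not part of the structure: as for representations on Hilbert
    spaces, it follows from the algebraic laws ([act_norm_le]). *)
Record star_action (R : realType) (A : cstarAlgType R) (V : lmodType R[i])
    (s : semi_inner V) := StarAction {
  act :> A -> V -> V ;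
  act_linearl : forall c a b v, act (c *: a + b) v = c *: act a v + act b v ;
  act_linearr : forall c a v w, act a (c *: v + w) = c *: act a v + act a w ;
  actM : forall a b v, act (cmul a b) v = act a (act b v) ;
  act_adj : forall a v w, s (act a v) w = s v (act (cstar a) w)
}.

Definition star_rep_action (R : realType) (A : cstarAlgType R)
  (H : hilbertType R) (l : star_rep A H) : star_action A (hilbert_semi_inner H).
Proof.
exists (fun a v => l a v) => [c a b v|c a v w|a b v|a v w].
- by rewrite linearP.
- by rewrite linearP.
- by rewrite star_repM.
- by rewrite /= adjointP star_rep_star.
Defined.

Section star_action_theory.
Variables (R : realType) (A : cstarAlgType R) (V : lmodType R[i]).
Variables (s : semi_inner V) (t : star_action A s).
Implicit Types (a b : A) (v w : V).

Lemma actDl a b v : t (a + b) v = t a v + t b v.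
Proof. by rewrite -(scale1r a) act_linearl !scale1r. Qed.

Lemma act0l v : t 0 v = 0.
Proof. by apply: (addrI (t 0 v)); rewrite -actDl !addr0. Qed.

Lemma actZl c a v : t (c *: a) v = c *: t a v.
Proof. by rewrite -[c *: a]addr0 act_linearl act0l addr0. Qed.

Lemma actNl a v : t (- a) v = - t a v.
Proof. by rewrite -(scaleN1r a) actZl scaleN1r. Qed.

(** When [b] has norm less than 1, writing [1 - b = (1 - d)^2] exhibits
    [s v v - s v (b v)] as the squared length of [v - d v]. The general case
    follows by scaling [b]. *)
Lemma act_selfadjoint_le b v : cstar b = b -> s v (t b v) <= `|b| * s v v.
Proof.
move=> bb.
have lt1 c : cstar c = c -> `|c| < 1 -> s v (t c v) <= s v v.
  move=> cc /(cstar_sqrt cc)[d [dd dc]].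
  have dadj w : s (t d v) w = s v (t d w) by rewrite act_adj dd.
  have := sdot_ge0 s (v - t d v).
  rewrite -dc !actDl actNl actM !sdotDr !sdotDl !sdotNl !sdotNr !dadj.
  set x := s v v; set y := s v (t d v); set z := s v _ => h.
  rewrite -subr_ge0 (_ : x - _ = x - y + (- y - - z)); first exact: h.
  by ring.
apply/ler_addgt0Pr => e e0.
pose p := s v v + 1.
have p0 : 0 < p by rewrite ltr_wpDl// sdot_ge0.
pose m := `|b| + e / p.
have m0 : 0 < m by rewrite ltr_wpDl// divr_gt0.
have mr : m^-1^* = m^-1 by rewrite conj_Creal// gtr0_real// invr_gt0.
have := lt1 (m^-1 *: b); rewrite cstarZ mr bb normrZ gtr0_norm ?invr_gt0//.
rewrite mulrC ltr_pdivrMr// mul1r ltrDl divr_gt0// => /(_ erefl isT).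
rewrite actZl sdotZr mulrC ler_pdivrMr// => h; apply: (le_trans h).
rewrite mulrC /m mulrDl lerD2l mulrAC ler_pdivrMr// ler_wpM2l// ?(ltW e0)//.
by rewrite lerDl.
Qed.

Lemma act_norm_le a v : (snorm s (t a v))%:C <= `|a| * (snorm s v)%:C.
Proof.
rewrite -(@ler_pXn2r _ 2) ?nnegrE ?mulr_ge0 ?snormC_ge0//.
rewrite exprMn !snorm_sqr act_adj -actM -cnorm_star.
by apply: act_selfadjoint_le; rewrite cstarM cstarK.
Qed.

End star_action_theory.

(** * Orthogonal projection onto the closure of a subspace *)

Definition is_subspace (K : pzRingType) (V : lmodType K) (S : set V) : Prop :=
  S 0 /\ forall c x y, S x -> S y -> S (c *: x + y).

Lemma linear_span_subspace (K : pzRingType) (V : lmodType K) (S : set V) :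
  is_subspace (linear_span S).
Proof.
split; first by exists 0%N, (fun=> 0), (fun=> 0); rewrite big_ord0;
  split=> // -[].
move=> c _ _ [n [a [w [wS ->]]]] [m [b [z [zS ->]]]].
exists (n + m)%N, (fun i : 'I_(n + m) =>
  match fintype.split i with inl j => c * a j | inr j => b j end).
exists (fun i : 'I_(n + m) =>
  match fintype.split i with inl j => w j | inr j => z j end).
split=> [i|]; first by case: fintype.split.
rewrite big_split_ord /= scaler_sumr; congr (_ + _); apply: eq_bigr => i _.
  by rewrite (unsplitK (inl i)) scalerA.
by rewrite (unsplitK (inr i)).
Qed.

Lemma sub_linear_span (K : pzRingType) (V : lmodType K) (S : set V) v :
  S v -> linear_span S v.
Proof.
move=> Sv; exists 1%N, (fun=> 1), (fun=> v); split=> //.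
by rewrite big_ord1 scale1r.
Qed.

Lemma closure_normP (R : realType) (V : normedModType R[i]) (S : set V) v :
  closure S v <->
  forall e : R, 0 < e -> exists2 x, S x & `|v - x| <= e%:C.
Proof.
split=> [Sv e e0|Sv B /nbhs_ballP[e /= e0 eB]].
  have eC : 0 < e%:C by rewrite ltcR.
  have [x [Sx]] := Sv _ (nbhsx_ballx v _ eC).
  by rewrite -ball_normE /= => /ltW vx; exists x.
have eE : e = (complex.Re e)%:C by rewrite RRe_real// gtr0_real.
have e0' : 0 < complex.Re e by rewrite -ltcR -eE.
have [|x Sx vx] := Sv (complex.Re e / 2); first by rewrite divr_gt0.
exists x; split=> //; apply: eB; rewrite -ball_normE /=.
apply: (le_lt_trans vx); rewrite eE ltcR ltr_pdivrMr// mulr_natr mulr2n.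
by rewrite ltrDl.
Qed.

Section projection.
Variables (R : realType) (H : hilbertType R).
Implicit Types (x y : H) (S : set H).

Let nr x : R := snorm (hilbert_semi_inner H) x.

Let nrE x : (nr x)%:C = `|x|.
Proof. exact: hilbert_snorm. Qed.

Let parallelogram x y :
  nr (x + y) ^+ 2 + nr (x - y) ^+ 2 = 2 * nr x ^+ 2 + 2 * nr y ^+ 2.
Proof.
apply: (@complexI R);
  rewrite !rmorphD !rmorphXn !(rmorphM _ 2) !rmorphXn/= !nrE -!hdot_norm.
rewrite rmorph_nat !(hdotDl, hdotDr, hdotNl, hdotNr).
ring.
Qed.

Let projection_error x w : x != 0 ->
  `|w - (hdot x w / `|x| ^+ 2) *: x| ^+ 2 =
  `|w| ^+ 2 - `|hdot x w| ^+ 2 / `|x| ^+ 2.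
Proof.
move=> x0; have xx0 : hdot x x != 0.
  by rewrite hdot_norm sqrf_eq0 normr_eq0.
rewrite -!hdot_norm normCK hdotC.
rewrite !(hdotDl, hdotDr, hdotNl, hdotNr, hdotZl, hdotZr).
rewrite rmorphM/= fmorphV/= !hdotC.
by field.
Qed.

(** A sequence of points of [S] at nearly minimal distance from [h] is Cauchy
    by the parallelogram law; moving such a point within [S] cannot decrease
    the distance by much, so [h - u n] is nearly orthogonal to [S]. *)
Lemma hilbert_projection S h : is_subspace S ->
  exists p, closure S p /\ forall x, S x -> hdot x (h - p) = 0.
Proof.
move=> [S0 SD].
pose E : set R := [set nr (h - x) ^+ 2 | x in S].
pose d := inf E.
have Einf : has_inf E.
  by split; [exists (nr (h - 0) ^+ 2), 0 | exists 0 => _ [x _ <-];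
    exact: sqr_ge0].
have dle x : S x -> d <= nr (h - x) ^+ 2.
  by move=> Sx; apply: ge_inf; [case: Einf | exists x].
pose r n : R := n.+1%:R^-1.
have r0 n : 0 < r n by rewrite invr_gt0.
(* The square makes the distances between the [u n] linear in [r]. *)
have /choice[u uP] n : exists x, S x /\ nr (h - x) ^+ 2 < d + r n ^+ 2.
  have [_ [x Sx <-] xd] := inf_adherent (exprn_gt0 2 (r0 n)) Einf.
  by exists x.
have uS n : S (u n) by case: (uP n).
have ud n : nr (h - u n) ^+ 2 < d + r n ^+ 2 by case: (uP n).
have ucauchy m n : nr (u m - u n) <= 2 * r m + 2 * r n.
  have rr : 0 <= 2 * r m + 2 * r n by rewrite addr_ge0// mulr_ge0// ltW.
  rewrite -(@ler_pXn2r _ 2) ?nnegrE ?snorm_ge0//.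
  have := parallelogram (h - u m) (h - u n).
  have -> : h - u m - (h - u n) = u n - u m.
    by rewrite opprB addrC addrA subrK.
  have Smid : S ((2^-1 : R[i]) *: (u m + u n)).
    rewrite -[_ *: _]addr0; apply: (SD) => //.
    by rewrite -[u m]scale1r; exact: SD.
  have := dle _ Smid.
  have -> : h - u m + (h - u n) =
      (2 : R[i]) *: (h - (2^-1 : R[i]) *: (u m + u n)).
    rewrite scalerBr scalerA divff ?pnatr_eq0// scale1r scaler_nat mulr2n.
    by rewrite opprD addrACA.
  have nZ x : nr ((2 : R[i]) *: x) ^+ 2 = 4 * nr x ^+ 2.
    apply: (@complexI R); rewrite (rmorphM _ 4) !rmorphXn/= !nrE normrZ exprMn.
    by rewrite rmorph_nat normr_nat -natrX.
  rewrite nZ.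
  have -> : nr (u n - u m) = nr (u m - u n).
    by apply: (@complexI R); rewrite !nrE distrC.
  move: (nr (h - _)) (nr (u m - _)) (ud m) (ud n) => a b.
  move: (nr (h - u m)) (nr (h - u n)) (r0 m) (r0 n) => a1 a2.
  move: (r m) (r n) => r1 r2 r1p r2p h1 h2 h3 h4.
  have := mulr_ge0 (ltW r1p) (ltW r2p); nra.
have rv : vanishing r by exact: vanishing_natSinv.
have r2v : vanishing (fun n => 2 * r n) by exact: vanishing_mul.
have [|||p pP] := @complete_at_rate R[i] H u (fun n => (2 * r n)%:C).
- by move=> n; rewrite ler0c mulr_ge0// ltW.
- exact: vanishing_complex.
- by move=> m n; rewrite -nrE -rmorphD lecR.
exists p; split.
  apply/closure_normP => e /r2v[N NP]; exists (u N) => //.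
  by rewrite distrC; apply: (le_trans (pP N)); rewrite lecR ltW// NP.
move=> x Sx; apply/eqP; rewrite -normr_eq0; apply/eqP.
have near n : `|hdot x (h - u n)| <= `|x| * (r n)%:C.
  have rC0 : 0 <= (r n)%:C by rewrite ler0c ltW.
  rewrite -(@ler_pXn2r _ 2) ?nnegrE ?mulr_ge0//.
  have [->|x0] := eqVneq x 0.
    by rewrite hdot0l normr0 expr0n /= exprn_ge0// mulr_ge0.
  (* The best correction of [u n] along [x] has this coefficient. *)
  have := dle _ (SD (hdot x (h - u n) / `|x| ^+ 2) _ _ Sx (uS n)).
  rewrite opprD addrA addrAC -lecR rmorphXn/= nrE projection_error// => dn.
  have := ud n; rewrite -ltcR rmorphD !rmorphXn/= nrE => /ltW wd.
  rewrite exprMn mulrC -ler_pdivrMr ?exprn_gt0 ?normr_gt0//.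
  rewrite -(lerD2l d%:C); apply: le_trans wd.
  by rewrite -lerBrDr.
apply: (@eq0_of_vanishing _ _ _ (3 * `|x|) (vanishing_complex rv)) => [||n];
  rewrite ?mulr_ge0//.
 rewrite (_ : h - p = (h - u n) + (u n - p)); last first.
  by rewrite addrA subrK.
rewrite hdotDr; apply: (le_trans (ler_normD _ _)).
rewrite -mulrA (_ : 3 = 1 + 2 :> R[i]); last by rewrite -natr1 addrC.
rewrite mulrDl mul1r lerD//; apply: (le_trans (cauchy_schwarz _ _)).
rewrite mulrCA ler_wpM2l//; apply: (le_trans (pP n)).
by rewrite rmorphM/= rmorph_nat.
Qed.

Lemma dense_of_trivial_orthogonal S : is_subspace S ->
  (forall y, (forall x, S x -> hdot x y = 0) -> y = 0) -> closure S = setT.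
Proof.
move=> SS Sorth; apply/seteqP; split=> // h _.
have [p [Sp ph]] := hilbert_projection h SS.
by have /eqP := Sorth _ ph; rewrite subr_eq0 => /eqP ->.
Qed.

Lemma closure_orthogonal S y : (forall x, S x -> hdot x y = 0) ->
  forall x, closure S x -> hdot x y = 0.
Proof.
move=> Sy x /closure_normP Sx; apply/eqP; rewrite -normr_eq0; apply/eqP.
have rv := vanishing_complex (@vanishing_natSinv R).
apply: (eq0_of_vanishing rv (normr_ge0 y)) => // n.
have [|z Sz xz] := Sx (n.+1%:R^-1); first by rewrite invr_gt0.
rewrite -(subrK z x) hdotDl (Sy _ Sz) addr0 mulrC.
by apply: (le_trans (cauchy_schwarz _ _)); rewrite ler_wpM2r.
Qed.

End projection.

(** * Completion of a pre-Hilbert space *)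

Section completion_def.
Variables (R : realType) (V : lmodType R[i]) (s : semi_inner V).
Implicit Types (u v w : V) (e M : R) (f g : V -> R[i]^o).

Local Notation n := (snorm s).

Definition dual_bound M f : Prop := forall v, `|f v| <= (M * n v)%:C.

Definition antilinear f : Prop :=
  forall c v w, f (c *: v + w) = c^* * f v + f w.

Definition sdot_at u : V -> R[i]^o := fun v => s v u.

(** The completion is realized as the closure, in the antilinear dual of [V],
    of the functionals [s v u]. Vectors of length 0 are thereby
    identified, and completeness reduces to that of the scalars. *)
Definition completion_set : set (V -> R[i]^o) := [set f |
  antilinear f /\ forall e, 0 < e -> exists u, dual_bound e (f - sdot_at u)].

Definition completion_pred : {pred V -> R[i]^o} := mem completion_set.

Lemma completion_predP f : reflect (completion_set f) (f \in completion_pred).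
Proof. by apply: (iffP idP); rewrite !inE. Qed.

Record completion :=
  Completion { completion_fun :> V -> R[i]^o ;
    _ : completion_fun \in completion_pred }.

HB.instance Definition _ := [isSub of completion for completion_fun].
HB.instance Definition _ := [Choice of completion by <:].

Lemma dual_boundD M1 M2 f g :
  dual_bound M1 f -> dual_bound M2 g -> dual_bound (M1 + M2) (f + g).
Proof.
move=> fM gM v; rewrite mulrDl rmorphD/=.
by apply: (le_trans (ler_normD _ _)); apply: lerD.
Qed.

Lemma dual_boundZ c M f :
  dual_bound M f -> dual_bound (complex.Re `|c| * M) (c *: f).
Proof.
have := RRe_real (normr_real c); move: (complex.Re _) => k kE fM v.
rewrite -mulrA rmorphM/= kE [X in `|X|](_ : _ = c * f v)// normrM.
by rewrite ler_wpM2l.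
Qed.

Lemma dual_bound_le M1 M2 f : M1 <= M2 -> dual_bound M1 f -> dual_bound M2 f.
Proof.
move=> M12 fM v; apply: (le_trans (fM v)).
by rewrite lecR ler_wpM2r// snorm_ge0.
Qed.

Lemma sdot_at_linear c u v : sdot_at (c *: u + v) = c *: sdot_at u + sdot_at v.
Proof.
by apply/funext => w; rewrite /sdot_at sdotDr sdotZr.
Qed.

Lemma sdot_at_bound u : dual_bound (n u) (sdot_at u).
Proof.
by move=> v; rewrite mulrC; exact: sdot_cauchy_schwarz.
Qed.

Lemma completion_submod_closed : submod_closed completion_pred.
Proof.
split=> [|c f g /completion_predP[fl fa] /completion_predP[gl ga]].
  apply/completion_predP; split=> [c v w|e e0].
    by rewrite -[LHS]/0 -[f in _ + f]/0 -[X in _ * X]/0 mulr0 addr0.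
  exists 0 => v; rewrite [X in `|X|](_ : _ = 0); last first.
    by rewrite -[LHS]/(0 - s v 0) sdot0r subr0.
  by rewrite normr0 ler0c mulr_ge0 ?snorm_ge0// ltW.
apply/completion_predP; split=> [d v w|e e0].
  rewrite -[LHS]/(c * f _ + g _).
  rewrite -[RHS]/(d^* * (c * f v + g v) + (c * f w + g w)).
  by rewrite fl gl; ring.
pose k : R := complex.Re `|c|.
have k0 : 0 <= k by rewrite -ler0c RRe_real ?normr_real.
have k1 : 0 < k + 1 by rewrite ltr_wpDl.
have e1 : 0 < e / (k + 1) by rewrite divr_gt0.
have [u uP] := fa _ e1; have [w wP] := ga _ e1.
exists (c *: u + w); rewrite sdot_at_linear opprD addrACA -scalerBr.
apply: dual_bound_le (dual_boundD (dual_boundZ c uP) wP).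
by rewrite -/k -[X in _ + X]mul1r -mulrDl mulrC divfK// gt_eqF.
Qed.

HB.instance Definition _ :=
  GRing.isSubmodClosed.Build _ _ completion_pred completion_submod_closed.
HB.instance Definition _ := [SubChoice_isSubLmodule of completion by <:].

Lemma completionP (f : completion) : completion_set f.
Proof. by case: f => f /= /completion_predP. Qed.

Lemma completion_ext (f g : completion) : (forall v, f v = g v) -> f = g.
Proof. by move=> fg; apply/val_inj/funext. Qed.

Definition dual_norm f : R := inf [set M : R | 0 <= M /\ dual_bound M f].

Lemma dual_norm_le M f : 0 <= M -> dual_bound M f -> dual_norm f <= M.
Proof. by move=> M0 fM; apply: ge_inf => //; exists 0 => ? []. Qed.

Lemma completion_bounded (f : completion) : exists M, 0 <= M /\ dual_bound M f.
Proof.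
have [_ /(_ 1 ltr01)[u uP]] := completionP f.
exists (1 + n u); split; first by rewrite addr_ge0// snorm_ge0.
by rewrite -[X in dual_bound _ X](subrK (sdot_at u));
  apply: dual_boundD uP (sdot_at_bound u).
Qed.

Lemma dual_norm_ge0 (f : completion) : 0 <= dual_norm f.
Proof.
by apply: lb_le_inf => [|M []//]; have [M MP] := completion_bounded f; exists M.
Qed.

Lemma dual_normP (f : completion) : dual_bound (dual_norm f) f.
Proof.
move=> v; have [M0 [M00 fM0]] := completion_bounded f.
have [v0|v0] := eqVneq (n v) 0.
  by have := fM0 v; rewrite v0 !mulr0.
have vp : 0 < n v by rewrite lt_neqAle eq_sym v0 snorm_ge0.
have fr : `|f v| = (complex.Re `|f v|)%:C by rewrite RRe_real ?normr_real.
rewrite fr lecR -ler_pdivrMr//; apply: lb_le_inf; first by exists M0.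
by move=> M [_ /(_ v)]; rewrite fr lecR ler_pdivrMr.
Qed.

Let N (f : completion) : R[i] := (dual_norm f)%:C.

Let N_triangle (f g : completion) : N (f + g) <= N f + N g.
Proof.
rewrite /N -rmorphD lecR; apply: dual_norm_le.
  by rewrite addr_ge0 ?dual_norm_ge0.
by apply: dual_boundD; exact: dual_normP.
Qed.

Let N_scale_le c (f : completion) : N (c *: f) <= `|c| * N f.
Proof.
rewrite -(RRe_real (normr_real c)) -rmorphM lecR; apply: dual_norm_le.
  by rewrite mulr_ge0 ?dual_norm_ge0// -ler0c RRe_real ?normr_real.
by apply: dual_boundZ; exact: dual_normP.
Qed.

Let N_scale c (f : completion) : N (c *: f) = `|c| * N f.
Proof.
apply/eqP; rewrite eq_le N_scale_le /=.
have [->|c0] := eqVneq c 0.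
  by rewrite normr0 mul0r ler0c dual_norm_ge0.
have cp : 0 < `|c| by rewrite normr_gt0.
rewrite mulrC -ler_pdivlMr// mulrC -normfV.
by apply: le_trans (N_scale_le _ _); rewrite scalerA mulVf// scale1r.
Qed.

Let N_eq0 (f : completion) : N f = 0 -> f = 0.
Proof.
move=> /(@complexI R) f0; apply: completion_ext => v.
have := dual_normP f v; rewrite f0 mul0r normr_le0 => /eqP //.
Qed.

HB.instance Definition _ := Lmodule_isNormed.Build R[i] completion
  N_triangle N_scale N_eq0.

Lemma completion_norm (f : completion) : `|f| = (dual_norm f)%:C.
Proof. by []. Qed.

Lemma completion_eval_le (f : completion) v : `|f v| <= `|f| * (n v)%:C.
Proof. by rewrite completion_norm -rmorphM/=; exact: dual_normP. Qed.

Lemma completion_norm_le (f : completion) M :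
  0 <= M -> dual_bound M f -> `|f| <= M%:C.
Proof. by move=> M0 fM; rewrite completion_norm lecR; exact: dual_norm_le. Qed.

(** A Cauchy filter yields a sequence [f k] that is Cauchy at the rate [r k],
    hence converges pointwise; that the limit [g] approximates [f k] in the
    dual norm puts [g] in the completion and makes it the limit of the
    filter. *)
Lemma completion_complete (F : set_system completion) :
  ProperFilter F -> cauchy F -> cvg F.
Proof.
move=> PF /cauchyP Fc.
pose r k : R := k.+1%:R^-1.
have r0 k : 0 < r k by rewrite invr_gt0.
have rv : vanishing r by exact: vanishing_natSinv.
have /choice[f fP] k : exists h, F (ball h (r k)%:C).
  by apply: Fc; rewrite ltcR.
have ff k l : `|f k - f l| <= (r k + r l)%:C.
  have [h [/= hk hl]] := @filter_ex _ F PF _ (filterI (fP k) (fP l)).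
  rewrite -(subrK h (f k)) -addrA rmorphD; apply: (le_trans (ler_normD _ _)).
  move: hk hl; rewrite -!ball_normE /= => /ltW hk /ltW hl.
  by rewrite lerD// distrC.
have /choice[g gP] v : exists z, forall k, `|f k v - z| <= (2 * (r k * n v))%:C.
  apply: complex_complete_at_rate => [k||k l].
  - by rewrite mulr_ge0 ?snorm_ge0// ltW.
  - have := vanishing_mul (snorm_ge0 s v) rv.
    by under [X in _ -> vanishing X]eq_fun do rewrite mulrC.
  rewrite -mulrDl rmorphM/=;
    apply: (le_trans (completion_eval_le (f k - f l) v)).
  by rewrite ler_wpM2r ?snormC_ge0.
have fg k : dual_bound (2 * r k) (g - f k).
  by move=> v; rewrite distrC -mulrA.
have fg_le k v : `|g v - f k v| <= (2 * n v)%:C * (r k)%:C.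
  by apply: (le_trans (fg k v));
    rewrite -(rmorphM (real_complex R)) lecR mulrAC.
have gin : g \in completion_pred.
  apply/completion_predP; split=> [c v w|e e0].
    apply/eqP; rewrite -subr_eq0 -normr_eq0; apply/eqP.
    pose C := (2 * n (c *: v + w))%:C + `|c| * (2 * n v)%:C + (2 * n w)%:C.
    have C0 (x : V) : 0 <= (2 * n x)%:C by rewrite ler0c mulr_ge0 ?snorm_ge0.
    apply: (@eq0_of_vanishing _ _ _ C (vanishing_complex rv)) => [||k] //.
      by rewrite !addr_ge0// mulr_ge0.
    have [fl _] := completionP (f k).
    rewrite (_ : g _ - _ = (g (c *: v + w) - f k (c *: v + w)) -
      c^* * (g v - f k v) - (g w - f k w)); last by rewrite fl; ring.
    rewrite /C 2!(mulrDl _ _ (r k)%:C); apply: (le_trans (ler_normB _ _));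
      apply: lerD; last first.
      exact: fg_le.
    apply: (le_trans (ler_normB _ _)); apply: lerD.
      exact: fg_le.
    by rewrite normrM norm_conjC -mulrA ler_wpM2l.
  have e20 : 0 < e / 2 by rewrite divr_gt0.
  have [k kP] := vanishing_mul (ler0n R 2) rv e20.
  have [_ /(_ _ e20)[u uP]] := completionP (f k).
  exists u; rewrite -(subrK (f k : V -> _) g) -addrA (splitr e).
  apply: dual_boundD uP.
  by apply: dual_bound_le (fg k); rewrite ltW// kP.
apply/cvg_ex; exists (Completion gin).
apply/cvg_ballP => e e0.
have rv3 : vanishing (fun k => (3 * r k)%:C).
  by apply: vanishing_complex; exact: vanishing_mul.
have [k kP] := rv3 e e0.
apply: filterS (fP k) => h; rewrite -!ball_normE /= => fh.
apply: le_lt_trans (kP k (leqnn k)).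
rewrite -(subrK (f k) (Completion gin)) -addrA;
  apply: (le_trans (ler_normD _ _)).
rewrite (_ : 3 * r k = 2 * r k + r k); last by ring.
rewrite rmorphD; apply: lerD; last exact: ltW.
apply: completion_norm_le; first by rewrite mulr_ge0// ltW.
exact: fg.
Qed.

HB.instance Definition _ :=
  Uniform_isComplete.Build completion completion_complete.
HB.instance Definition _ := Complete.on completion.
End completion_def.

Section completion_hilbert.
Variables (R : realType) (V : lmodType R[i]) (s : semi_inner V).
Implicit Types (u v w : V) (f g h : completion s).

Local Notation n := (snorm s).

Lemma embed_subproof u : sdot_at s u \in completion_pred s.
Proof.
apply/completion_predP; split=> [c v w|e e0].
  by rewrite /sdot_at sdotDl sdotZl.
exists u => v; rewrite subrr [X in `|X|](_ : _ = 0)// normr0.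
by rewrite ler0c mulr_ge0 ?snorm_ge0// ltW.
Qed.

Definition embed u : completion s := Completion (embed_subproof u).

Lemma embedE u v : embed u v = s v u.
Proof. by []. Qed.

Lemma embed_linear c u v : embed (c *: u + v) = c *: embed u + embed v.
Proof. by apply: completion_ext => w; rewrite !embedE sdotDr sdotZr. Qed.

Lemma embed_dense f (e : R) : 0 < e -> exists u, `|f - embed u| <= e%:C.
Proof.
move=> e0; have [_ /(_ _ e0)[u uP]] := completionP f.
by exists u; apply: completion_norm_le => //; exact: ltW.
Qed.

Lemma norm_embed u : `|embed u| = (n u)%:C.
Proof.
apply/eqP; rewrite eq_le completion_norm_le ?snorm_ge0//=;
  last exact: sdot_at_bound.
have [->|u0] := eqVneq (n u) 0; first by rewrite normr_ge0.
have up : 0 < (n u)%:C by rewrite ltcR lt_neqAle eq_sym u0 snorm_ge0.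
rewrite -(ler_pM2r up) -expr2 snorm_sqr.
by apply: le_trans (completion_eval_le _ _); rewrite embedE ger0_norm ?sdot_ge0.
Qed.

Lemma completion_linear f c u v : f (c *: u + v) = c^* * f u + f v.
Proof. by have [] := completionP f. Qed.

Lemma completion_add f u v : f (u + v) = f u + f v.
Proof. by rewrite -[u]scale1r completion_linear conjC1 mul1r scale1r. Qed.

Lemma completion_scale f c u : f (c *: u) = c^* * f u.
Proof.
have f0 : f 0 = 0 by apply: (addrI (f 0)); rewrite -completion_add !addr0.
by rewrite -[c *: u]addr0 completion_linear f0 addr0.
Qed.

Lemma completion_sub f u v : f (u - v) = f u - f v.
Proof.
by rewrite completion_add -scaleN1r completion_scale rmorphN1 mulN1r.
Qed.

(** The inner product of [f] and [embed u] must be the conjugate of [f u];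
    the displayed estimate says that it depends continuously on [embed u] and
    thus determines the inner product of [f] with any [g]. *)
Lemma completion_dot_exists f g :
  exists z : R[i], forall u, `|z - (f u)^*| <= `|f| * `|g - embed u|.
Proof.
pose r k : R := k.+1%:R^-1.
have r0 k : 0 < r k by rewrite invr_gt0.
have rv : vanishing r by exact: vanishing_natSinv.
have /choice[u uP] k : exists u, `|g - embed u| <= (r k)%:C.
  exact: embed_dense.
have fr : (complex.Re `|f|)%:C = `|f| by rewrite RRe_real ?normr_real.
have f0 : 0 <= complex.Re `|f| by rewrite -ler0c fr.
have fB v w : `|(f v)^* - (f w)^*| <= `|f| * `|embed v - embed w|.
  rewrite -rmorphB norm_conjC -completion_sub.
  have -> : embed v - embed w = embed (v - w).
    by rewrite -[v - w]addrC -scaleN1r embed_linear scaleN1r addrC.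
  by rewrite norm_embed; exact: completion_eval_le.
have uu k l : `|embed (u k) - embed (u l)| <= (r k + r l)%:C.
  rewrite -(subrK g (embed (u k))) -addrA rmorphD;
    apply: (le_trans (ler_normD _ _)).
  by rewrite lerD// distrC.
have [|||z zP] := @complex_complete_at_rate R (fun k => (f (u k))^*)
    (fun k => complex.Re `|f| * r k).
- by move=> k; rewrite mulr_ge0// ltW.
- exact: vanishing_mul.
- move=> k l; rewrite -mulrDr rmorphM/= fr.
  by apply: (le_trans (fB _ _)); rewrite ler_wpM2l.
exists z => v.
apply: (@le_of_vanishing _ (fun k => (3 * (complex.Re `|f| * r k))%:C)) => [|k].
  by apply: vanishing_complex; do 2 apply: vanishing_mul => //.
rewrite -(subrK (f (u k))^* z) -addrA; apply: (le_trans (ler_normD _ _)).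
rewrite (_ : 3 * _ = complex.Re `|f| * r k + 2 * (complex.Re `|f| * r k));
  last by ring.
rewrite rmorphD addrA [leRHS]addrC; apply: lerD.
  by rewrite distrC.
rewrite rmorphM/= fr -mulrDr; apply: (le_trans (fB _ _)); rewrite ler_wpM2l//.
rewrite -(subrK g (embed (u k))) -addrA [leRHS]addrC;
  apply: (le_trans (ler_normD _ _)).
by rewrite lerD// distrC.
Qed.

Definition completion_dot f g : R[i] :=
  projT1 (cid (completion_dot_exists f g)).

Lemma completion_dotP f g u :
  `|completion_dot f g - (f u)^*| <= `|f| * `|g - embed u|.
Proof. by rewrite /completion_dot; case: cid => z /=. Qed.

Let eq_of_small (x y c : R[i]) : 0 <= c ->
  (forall e : R, 0 < e -> e <= 1 -> `|x - y| <= c * e%:C) -> x = y.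
Proof.
move=> c0 h; apply/eqP; rewrite -subr_eq0 -normr_eq0; apply/eqP.
have rv := vanishing_complex (@vanishing_natSinv R).
apply: (eq0_of_vanishing rv c0) => // k.
by apply: h; rewrite ?invr_gt0// invf_le1// ler1n.
Qed.

Let completion_dotDr f : {morph completion_dot f : g h / g + h}.
Proof.
move=> g h; apply: (@eq_of_small _ _ (4 * `|f|)); first by rewrite mulr_ge0.
move=> e e0 _; have [u ug] := embed_dense g e0; have [w wh] := embed_dense h e0.
have D := completion_dotP f (g + h) (u + w).
have uw : embed (u + w) = embed u + embed w.
  by have := embed_linear 1 u w; rewrite !scale1r.
have Dle : `|g + h - embed (u + w)| <= e%:C + e%:C.
  rewrite uw opprD addrACA; apply: (le_trans (ler_normD _ _)); exact: lerD.
rewrite (_ : completion_dot f (g + h) - _ =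
  (completion_dot f (g + h) - (f (u + w))^*)
  - ((completion_dot f g - (f u)^*) + (completion_dot f h - (f w)^*)));
    last first.
  rewrite completion_add rmorphD/=.
  move: (completion_dot f _) (completion_dot f g) (completion_dot f h) => x y z.
  by ring.
rewrite (_ : 4 * `|f| * e%:C =
  `|f| * (e%:C + e%:C) + (`|f| * e%:C + `|f| * e%:C)); last by ring.
apply: (le_trans (ler_normB _ _)); apply: lerD.
  by apply: (le_trans D); rewrite ler_wpM2l.
by apply: (le_trans (ler_normD _ _)); apply: lerD;
  apply: (le_trans (completion_dotP _ _ _)); rewrite ler_wpM2l.
Qed.

Let completion_dotZr f c g : completion_dot f (c *: g) = c * completion_dot f g.
Proof.
apply: (@eq_of_small _ _ (2 * `|c| * `|f|)); first by rewrite !mulr_ge0.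
move=> e e0 _; have [u ug] := embed_dense g e0.
have D := completion_dotP f (c *: g) (c *: u).
have cu : embed (c *: u) = c *: embed u.
  by apply: completion_ext => v; rewrite embedE sdotZr.
rewrite (_ : completion_dot f (c *: g) - _ =
  (completion_dot f (c *: g) - (f (c *: u))^*)
  - c * (completion_dot f g - (f u)^*)); last first.
  rewrite completion_scale rmorphM/= conjCK.
  by move: (completion_dot f _) (completion_dot f g) => x y; ring.
rewrite (_ : 2 * `|c| * `|f| * e%:C =
  `|f| * (`|c| * e%:C) + `|c| * (`|f| * e%:C)); last by ring.
apply: (le_trans (ler_normB _ _)); apply: lerD.
  apply: (le_trans D); rewrite ler_wpM2l// cu -scalerBr normrZ ler_wpM2l//.
rewrite normrM ler_wpM2l//.
by apply: (le_trans (completion_dotP _ _ _)); rewrite ler_wpM2l.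
Qed.

Let embed_near f (e : R) u : e <= 1 -> `|f - embed u| <= e%:C ->
  (n u)%:C <= `|f| + 1.
Proof.
move=> e1 fu; rewrite -norm_embed -(subrK f (embed u)) addrC.
apply: (le_trans (ler_normD _ _)); rewrite lerD2l distrC.
by apply: (le_trans fu); rewrite -[1]/(1%:C) lecR.
Qed.

Let completion_dotC f g : (completion_dot f g)^* = completion_dot g f.
Proof.
apply: (@eq_of_small _ _ (`|f| + `|g| + (`|g| + 1) + (`|f| + 1))).
  by rewrite !addr_ge0.
move=> e e0 e1.
have [u ug] := embed_dense g e0; have [w wf] := embed_dense f e0.
have F := completion_dotP f g u; have G := completion_dotP g f w.
have Fu := completion_eval_le (f - embed w) u.
have Gw := completion_eval_le (g - embed u) w.
rewrite (_ : (completion_dot f g)^* - completion_dot g f =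
  (completion_dot f g - (f u)^*)^* - (completion_dot g f - (g w)^*)
  + (f u - s u w) - (g w - s w u)^*); last first.
  rewrite !rmorphB/= !conjCK sdotC.
  by move: (completion_dot f g)^* (completion_dot g f) => x y; ring.
rewrite !mulrDl; apply: (le_trans (ler_normB _ _)); apply: lerD; last first.
  rewrite norm_conjC; apply: (le_trans Gw).
  by rewrite mulrC -mulrDl; apply: ler_pM => //;
    [exact: snormC_ge0 | exact: embed_near wf].
apply: (le_trans (ler_normD _ _)); apply: lerD; last first.
  apply: (le_trans Fu).
  by rewrite mulrC -mulrDl; apply: ler_pM => //;
    [exact: snormC_ge0 | exact: embed_near ug].
apply: (le_trans (ler_normB _ _)); apply: lerD.
  by rewrite norm_conjC; apply: (le_trans F); rewrite ler_wpM2l.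
by apply: (le_trans G); rewrite ler_wpM2l.
Qed.

Let completion_dot_norm f : completion_dot f f = `|f| ^+ 2.
Proof.
apply: (@eq_of_small _ _ (`|f| + (`|f| + 1) + (`|f| + 1 + `|f|))).
  by rewrite !addr_ge0.
move=> e e0 e1; have [u uf] := embed_dense f e0.
have F := completion_dotP f f u.
have Fu := completion_eval_le (f - embed u) u.
have nu := embed_near e1 uf.
have sc : (s u u)^* = s u u by rewrite sdotC.
rewrite (_ : completion_dot f f - _ = (completion_dot f f - (f u)^*)
  + (f u - s u u)^* - (`|f| ^+ 2 - s u u)); last first.
  rewrite !rmorphB/= sc.
  by move: (completion_dot f f) => x; ring.
rewrite (mulrDl (_ + _) (_ + _ + _)) (mulrDl `|f|).
apply: (le_trans (ler_normB _ _)); apply: lerD; last first.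
  rewrite -snorm_sqr -norm_embed subr_sqr normrM mulrC; apply: ler_pM => //.
    rewrite ger0_norm ?addr_ge0// [leRHS]addrC lerD// norm_embed //.
  by apply: le_trans (ler_dist_dist _ _) uf.
apply: (le_trans (ler_normD _ _)); apply: lerD.
  by apply: (le_trans F); rewrite ler_wpM2l.
rewrite norm_conjC; apply: (le_trans Fu).
by rewrite mulrC; apply: ler_pM => //; exact: snormC_ge0.
Qed.

HB.instance Definition _ :=
  CompleteNormedModule_isHilbert.Build R (completion s)
  completion_dotDr completion_dotZr completion_dotC completion_dot_norm.

(** The reproducing property: evaluations are inner products, so identities in
    the completion can be checked by evaluating functionals. *)
Lemma hdot_embed u f : hdot (embed u) f = f u.
Proof.
rewrite -hdotC; apply/eqP; rewrite -subr_eq0 -normr_eq0; apply/eqP.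
have := completion_dotP f (embed u) u; rewrite subrr normr0 mulr0 normr_le0.
move=> /eqP h; rewrite -(conjCK (f u)) -rmorphB norm_conjC.
by rewrite [X in `|X|]h normr0.
Qed.
End completion_hilbert.

(** * Extension of an action to the completion *)

Section completion_rep.
Variables (R : realType) (A : cstarAlgType R) (V : lmodType R[i]).
Variables (s : semi_inner V) (t : star_action A s).
Implicit Types (a b : A) (v w : V) (f g : completion s).

(** Precomposition with the action of [cstar a] is forced by
    [hdot (embed v) (a f) = hdot (embed (cstar a v)) f] and makes sense on all
    functionals, so no extension by density is needed. *)
Lemma completion_act_subproof a f :
  (fun v => f (t (cstar a) v)) \in completion_pred s.
Proof.
apply/completion_predP; split=> [c v w|e e0].
  by rewrite act_linearr completion_linear.
pose k : R := complex.Re `|a|.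
have kE : k%:C = `|a| by rewrite RRe_real ?normr_real.
have k0 : 0 <= k by rewrite -ler0c kE.
have k1 : 0 < k + 1 by rewrite ltr_wpDl.
have [u uP] := embed_dense f (divr_gt0 e0 k1).
exists (t a u) => v.
rewrite [X in `|X|](_ : _ = (f - embed s u) (t (cstar a) v)); last first.
  rewrite -[LHS]/(f (t (cstar a) v) - s v (t a u)) -{2}(cstarK a) -act_adj.
  by [].
apply: (le_trans (completion_eval_le _ _)).
apply: (@le_trans _ _ ((e / (k + 1))%:C * (k%:C * (snorm s v)%:C))).
  apply: ler_pM => //; first exact: snormC_ge0.
  by rewrite kE -norm_cstar; exact: act_norm_le.
rewrite -!rmorphM lecR mulrA ler_wpM2r ?snorm_ge0// mulrAC ler_pdivrMr//.
by rewrite ler_wpM2l ?(ltW e0)// lerDl.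
Qed.

Definition completion_act a f : completion s :=
  Completion (completion_act_subproof a f).

Lemma completion_act_blin a : completion_act a \in blinear.
Proof.
apply/blinearP; split=> [c f g|]; first by apply: completion_ext.
exists (complex.Re `|a|) => f; rewrite RRe_real ?normr_real//.
have fr : (complex.Re `|a| * complex.Re `|f|)%:C = `|a| * `|f|.
  by rewrite rmorphM/= !RRe_real ?normr_real.
rewrite -fr; apply: completion_norm_le => [|v].
  by rewrite -ler0c fr mulr_ge0.
rewrite rmorphM/= fr; apply: (le_trans (completion_eval_le _ _)).
rewrite mulrAC [leRHS]mulrC; apply: ler_wpM2l => //.
by rewrite -norm_cstar; exact: act_norm_le.
Qed.

Definition completion_op a : blin (completion s) (completion s) :=
  Blin (completion_act_blin a).

Lemma completion_opE a f v : completion_op a f v = f (t (cstar a) v).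
Proof. by []. Qed.

Lemma completion_op_linear c a b :
  completion_op (c *: a + b) = c *: completion_op a + completion_op b.
Proof.
apply: blin_ext => f; apply: completion_ext => v.
rewrite completion_opE cstarD cstarZ act_linearl completion_linear conjCK.
by [].
Qed.

HB.instance Definition _ :=
  GRing.isLinear.Build _ _ _ _ completion_op completion_op_linear.

Lemma completion_opM a b :
  completion_op (cmul a b) = blin_comp (completion_op a) (completion_op b).
Proof.
apply: blin_ext => f; apply: completion_ext => v.
by rewrite completion_opE cstarM actM.
Qed.

Lemma completion_op_embed a v : completion_op a (embed s v) = embed s (t a v).
Proof.
apply: completion_ext => w.
by rewrite completion_opE !embedE act_adj cstarK.
Qed.

Lemma completion_op_star a :
  completion_op (cstar a) = adjoint (completion_op a).
Proof.
apply: blin_ext => f; apply: completion_ext => v.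
rewrite -[RHS]hdot_embed -adjointP completion_op_embed hdot_embed.
by rewrite completion_opE cstarK.
Qed.

Definition completion_rep : star_rep A (completion s) :=
  {| star_rep_fun := completion_op ;
     star_repM := completion_opM ;
     star_rep_star := completion_op_star |}.

End completion_rep.

(** * Inner products of Hilbert modules *)

Section right_module_theory.
Variables (R : realType) (B : cstarAlgType R) (X : rightHilbertType B).
Implicit Types (x y z : X) (b : B).

Lemma rdotDl x y z : rdot (x + y) z = rdot x z + rdot y z :> B.
Proof. by rewrite -rdot_star rdotDr cstarD !rdot_star. Qed.

Lemma rdotZl c x y : rdot (c *: x) y = c^* *: rdot x y :> B.
Proof. by rewrite -rdot_star rdotZr cstarZ rdot_star. Qed.

Lemma rdot0r x : rdot x 0 = 0 :> B.
Proof. by rewrite -(scale0r (0 : X)) rdotZr scale0r. Qed.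

Lemma rdot0l x : rdot 0 x = 0 :> B.
Proof. by rewrite -(scale0r (0 : X)) rdotZl conjC0 scale0r. Qed.

Lemma rdotMl x b y : rdot (ract x b) y = cmul (cstar b) (rdot x y) :> B.
Proof. by rewrite -rdot_star rdotMr cstarM rdot_star. Qed.

Lemma rdot_suml (I : Type) (r : seq I) (F : I -> X) y :
  rdot (\sum_(i <- r) F i) y = \sum_(i <- r) rdot (F i) y :> B.
Proof.
by elim/big_rec2: _ => [|i a z _ <-]; rewrite ?rdot0l ?rdotDl.
Qed.

Lemma rdot_sumr (I : Type) (r : seq I) (F : I -> X) y :
  rdot y (\sum_(i <- r) F i) = \sum_(i <- r) rdot y (F i) :> B.
Proof.
by elim/big_rec2: _ => [|i a z _ <-]; rewrite ?rdot0r ?rdotDr.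
Qed.

End right_module_theory.

(** The compatibility of the two inner products determines [z * b] for
    [b = <a x, y> - <x, a^* y>] and every [z], namely 0. As [b] is itself a
    difference of inner products, this gives [b^* b = 0]. *)
Lemma rdot_lact (R : realType) (A B : cstarAlgType R)
    (X : hilbertBimodType A B) (a : A) (x y : X) :
  rdot (lact a x) y = rdot x (lact (cstar a) y) :> B.
Proof.
have ractN (z : X) (b : B) : ract z (- b) = - ract z b.
  by rewrite -scaleN1r ractZr scaleN1r.
set b1 : B := rdot (lact a x) y; set b2 : B := rdot x _.
have zb (z : X) : ract z (b1 - b2) = 0.
  rewrite ractDr ractN /b1 /b2 -!ldot_rdot -(ldot_star (lact a x)) ldotMl.
  by rewrite cstarM ldot_star lactA subrr.
have wzb (w z : X) : cmul (rdot w z) (b1 - b2) = 0.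
  by rewrite -rdotMr zb rdot0r.
apply/eqP; rewrite -subr_eq0; apply/eqP; apply: cstar_mul_eq0.
by rewrite cstarD cstarN !rdot_star cmulDl cmulNl !wzb subrr.
Qed.

(** * Positivity of the tensor product inner product *)

Section gram.
Variables (R : realType) (B : cstarAlgType R) (X : rightHilbertType B).
Variables (H : hilbertType R) (rho : star_rep B H).
Implicit Types (x y : X) (b : B) (h k : H) (l : seq (X * H)).

Lemma hdot_suml (I : Type) (r : seq I) (F : I -> H) h :
  hdot (\sum_(i <- r) F i) h = \sum_(i <- r) hdot (F i) h.
Proof.
by elim/big_rec2: _ => [|i a z _ <-]; rewrite ?hdot0l ?hdotDl.
Qed.

Lemma hdot_sumr (I : Type) (r : seq I) (F : I -> H) h :
  hdot h (\sum_(i <- r) F i) = \sum_(i <- r) hdot h (F i).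
Proof.
by elim/big_rec2: _ => [|i a z _ <-]; rewrite ?hdot0r ?hdotDr.
Qed.

Lemma star_rep_adj b h k : hdot (rho b h) k = hdot h (rho (cstar b) k).
Proof. exact: (act_adj (star_rep_action rho)). Qed.

Lemma star_rep_norm_le b h : `|rho b h| <= `|b| * `|h|.
Proof.
by have := act_norm_le (star_rep_action rho) b h; rewrite !hilbert_snorm.
Qed.

Lemma star_rep_positive b h : cpositive b -> 0 <= hdot h (rho b h).
Proof.
by case=> c ->; rewrite star_repM /= -star_rep_adj hdot_norm exprn_ge0.
Qed.

Lemma star_rep_rdot_ge0 x h : 0 <= hdot h (rho (rdot x x) h).
Proof. exact: star_rep_positive (rdot_ge0 x). Qed.

(** Such an [h] is orthogonal to all [rho (cstar b) k], which span a dense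
    subspace. *)
Lemma nondegenerate_eq0 h : nondegenerate_rep rho ->
  (forall b, rho b h = 0) -> h = 0.
Proof.
rewrite /nondegenerate_rep; set S := linear_span _ => nd bh.
apply/eqP; rewrite -normr_eq0 -sqrf_eq0 -hdot_norm; apply/eqP.
apply: (@closure_orthogonal _ _ S); last by rewrite nd.
move=> _ [n [c [w [wS ->]]]]; rewrite hdot_suml big1// => i _.
by have [b [k ->]] := wS i; rewrite hdotZl star_rep_adj bh hdot0r mulr0.
Qed.

Lemma star_rep_suml (I : Type) (r : seq I) (F : I -> B) h :
  rho (\sum_(i <- r) F i) h = \sum_(i <- r) rho (F i) h.
Proof.
by elim/big_rec2: _ => [|i a z _ <-]; rewrite ?linear0 ?linearD.
Qed.

(** The squared norm of the sum of the simple tensors of the pairs in [l]. *)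
Definition gram l : R[i] :=
  \sum_(p <- l) \sum_(q <- l) hdot p.2 (rho (rdot p.1 q.1) q.2).

(** When all vectors are of the form [rho b h] for one [h], moving each [b] to
    the module side turns the sum into a single simple tensor. *)
Lemma gram_cyclic (l : seq (X * B)) h :
  0 <= gram [seq (p.1, rho p.2 h) | p <- l].
Proof.
pose y := \sum_(p <- l) ract p.1 p.2.
suff -> : gram [seq (p.1, rho p.2 h) | p <- l] = hdot h (rho (rdot y y) h).
  exact: star_rep_rdot_ge0.
rewrite /gram big_map rdot_suml star_rep_suml hdot_sumr; apply: eq_bigr => p _.
rewrite big_map rdot_sumr star_rep_suml hdot_sumr; apply: eq_bigr => q _.
by rewrite rdotMl rdotMr /= star_rep_adj !star_repM.
Qed.

Definition orbit_set h : set H := [set v | exists b, v = rho b h].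

Lemma orbit_subspace h : is_subspace (orbit_set h).
Proof.
split; first by exists 0; rewrite linear0.
by move=> c _ _ [a ->] [b ->]; exists (c *: a + b); rewrite linearP.
Qed.

(** [gram] depends continuously on the vectors, at a rate controlled by [C], so
    positivity passes from the cyclic case to its closure. *)
Lemma gram_closure l h :
  (forall p, p \in l -> closure (orbit_set h) p.2) -> 0 <= gram l.
Proof.
move=> lh; pose r n : R := n.+1%:R^-1.
have r0 n : 0 < r n by rewrite invr_gt0.
have r1 n : r n <= 1 by rewrite invf_le1// ler1n.
have /choice[c cP] n : exists c : H -> B, forall k, closure (orbit_set h) k ->
    `|k - rho (c k) h| <= (r n)%:C.
  suff /choice[c cP] k : exists b, closure (orbit_set h) k ->
      `|k - rho b h| <= (r n)%:C by exists c.
  have [kh|nkh] := pselect (closure (orbit_set h) k); last by exists 0.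
  by have [_ [b ->] kb] := (closure_normP _ _).1 kh _ (r0 n); exists b.
pose C : R[i] := \sum_(p <- l) \sum_(q <- l)
  (`|rdot p.1 q.1 : B| * `|q.2| + (`|p.2| + 1) * `|rdot p.1 q.1 : B|).
have C0 : 0 <= C.
  by apply: sumr_ge0 => p _; apply: sumr_ge0 => q _;
    rewrite addr_ge0 ?mulr_ge0 ?addr_ge0.
apply: (@ge0_of_vanishing R
  (fun n => gram [seq (p.1, rho (c n p.2) h) | p <- l]) r _ C
  (@vanishing_natSinv R) C0).
  move=> n; have := gram_cyclic [seq (p.1, c n p.2) | p <- l] h.
  by rewrite -map_comp.
move=> n; rewrite /gram big_map -sumrB mulr_suml.
rewrite big_seq [leRHS]big_seq; apply: (le_trans (ler_norm_sum _ _ _)).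
apply: ler_sum => p pl; rewrite big_map -sumrB mulr_suml.
rewrite big_seq [leRHS]big_seq; apply: (le_trans (ler_norm_sum _ _ _)).
apply: ler_sum => q ql /=.
have := cP n _ (lh _ pl); have := cP n _ (lh _ ql).
move: (rho (c n p.2) h) (rho (c n q.2) h) => k1 k2 qk pk.
set b : B := rdot _ _.
rewrite (_ : _ - _ = hdot (p.2 - k1) (rho b q.2) + hdot k1 (rho b (q.2 - k2)));
  last first.
  by rewrite hdotDl hdotNl linearB hdotDr hdotNr addrA subrK.
apply: (le_trans (ler_normD _ _)); rewrite mulrDl; apply: lerD.
  apply: (le_trans (cauchy_schwarz _ _)); rewrite [leRHS]mulrC.
  by apply: ler_pM => //; exact: star_rep_norm_le.
apply: (le_trans (cauchy_schwarz _ _)); rewrite -mulrA; apply: ler_pM => //.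
  rewrite -(subrK p.2 k1) addrC; apply: (le_trans (ler_normD _ _)).
  rewrite lerD2l distrC; apply: (le_trans pk).
  by rewrite -[1]/(1%:C) lecR.
by apply: (le_trans (star_rep_norm_le _ _)); rewrite ler_wpM2l.
Qed.

Lemma orbit_orthogonal_stable h b k :
  (forall v, orbit_set h v -> hdot v k = 0) ->
  forall v, orbit_set h v -> hdot v (rho b k) = 0.
Proof.
move=> hk _ [a ->]; rewrite -[b]cstarK -star_rep_adj; apply: hk.
by exists (cmul (cstar b) a); rewrite star_repM.
Qed.

(** Induction on the number of vectors. Splitting all of them along the
    closure of the invariant subspace [rho B h] of the first vector [h]
    separates [gram]: one part is a limit of the cyclic case, and in the other
    the first vector has become 0, since nondegeneracy puts [h] in that
    closure. *)
Lemma gram_ge0 l : nondegenerate_rep rho -> 0 <= gram l.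
Proof.
move=> nd; have [m] := ubnP (size l); elim: m l => // m IH [|[x h] l] lm.
  by rewrite /gram big_nil.
have /choice[P PP] k : exists p, closure (orbit_set h) p /\
    forall v, orbit_set h v -> hdot v (k - p) = 0.
  exact: hilbert_projection (orbit_subspace h).
have Pin k : closure (orbit_set h) (P k) by case: (PP k).
have Pout k : forall v, orbit_set h v -> hdot v (k - P k) = 0 by case: (PP k).
(* As [rho B] is closed under adjoints and leaves the orbit invariant, it also
   leaves the orthogonal complement invariant, and the mixed terms vanish. *)
have cross1 k k' b : hdot (P k) (rho b (k' - P k')) = 0.
  apply: (closure_orthogonal (S := orbit_set h)); last exact: Pin.
  by apply: orbit_orthogonal_stable; exact: Pout.
have cross2 k k' b : hdot (k - P k) (rho b (P k')) = 0.
  by rewrite -[b]cstarK -star_rep_adj -hdotC cross1 conjC0.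
have h_in : h - P h = 0.
  apply: nondegenerate_eq0 nd _ => b; apply/eqP.
  rewrite -normr_eq0 -sqrf_eq0 -hdot_norm {1}linearB hdotDl hdotNl.
  rewrite (orbit_orthogonal_stable b (Pout h)); last by exists b.
  rewrite star_rep_adj (_ : rho _ (rho b _) = rho (cmul (cstar b) b) (h - P h)).
    by rewrite cross1 subr0.
  by rewrite star_repM.
have split_gram s : gram s = gram [seq (p.1, P p.2) | p <- s]
    + gram [seq (p.1, p.2 - P p.2) | p <- s].
  rewrite /gram !big_map -big_split; apply: eq_bigr => p _ /=.
  rewrite !big_map -big_split; apply: eq_bigr => q _ /=.
  rewrite -{1}(subrK (P p.2) p.2) -{1}(subrK (P q.2) q.2) linearD /=.
  by rewrite hdotDr !(hdotDl (_ - _)) cross1 cross2 addr0 add0r addrC.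
rewrite split_gram addr_ge0//.
  apply: (@gram_closure _ h) => _ /mapP[p _ ->]; exact: Pin.
rewrite /= h_in /gram big_cons big1 ?add0r; last by move=> q _; rewrite hdot0l.
under eq_bigr do rewrite big_cons linear0 hdot0r add0r.
by apply: IH; rewrite size_map.
Qed.

End gram.

(** * The interior tensor product *)

Section tensor_space.
Variables (R : realType) (B : cstarAlgType R) (X : rightHilbertType B).
Variables (H : hilbertType R) (rho : star_rep B H).
Implicit Types (x y : X) (b : B) (h k : H) (l : seq (X * H)).

Definition tensor_sum l : X -> H :=
  fun y => \sum_(p <- l) rho (rdot y p.1) p.2.

Definition tensor_set : set (X -> H) := [set f | exists l, f = tensor_sum l].

Definition tensor_pred : {pred X -> H} := mem tensor_set.

Lemma tensor_predP f : reflect (tensor_set f) (f \in tensor_pred).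
Proof. by apply: (iffP idP); rewrite !inE. Qed.

(** A finite sum of simple tensors is represented by the function pairing it
    with the elements of [X]; this makes the sums that the inner product does
    not distinguish equal, and no quotient is needed. *)
Record tensor_space :=
  TensorSpace { tensor_fun :> X -> H ; _ : tensor_fun \in tensor_pred }.

HB.instance Definition _ := [isSub of tensor_space for tensor_fun].
HB.instance Definition _ := [Choice of tensor_space by <:].

Lemma tensor_submod_closed : submod_closed tensor_pred.
Proof.
split=> [|c _ _ /tensor_predP[l ->] /tensor_predP[m ->]]; apply/tensor_predP.
  by exists [::]; apply/funext => y; rewrite /tensor_sum big_nil.
exists ([seq (p.1, c *: p.2) | p <- l] ++ m); apply/funext => y.
rewrite /tensor_sum big_cat big_map /=.
rewrite -[LHS]/(c *: (tensor_sum l y) + tensor_sum m y) scaler_sumr.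
by congr (_ + _); apply: eq_bigr => p _; rewrite linearZ.
Qed.

HB.instance Definition _ :=
  GRing.isSubmodClosed.Build _ _ tensor_pred tensor_submod_closed.
HB.instance Definition _ := [SubChoice_isSubLmodule of tensor_space by <:].

Lemma tensor_ext (f g : tensor_space) : (forall y, f y = g y) -> f = g.
Proof. by move=> fg; apply/val_inj/funext. Qed.

Lemma tensor_exists (f : tensor_space) : exists l, (f : X -> H) = tensor_sum l.
Proof. by case: f => f /= /tensor_predP. Qed.

Definition tensor_repr (f : tensor_space) := projT1 (cid (tensor_exists f)).

Lemma tensor_reprE (f : tensor_space) y : f y = tensor_sum (tensor_repr f) y.
Proof. by rewrite /tensor_repr; case: cid => l /= <-. Qed.

Definition tensor_dot (f g : tensor_space) : R[i] :=
  \sum_(p <- tensor_repr f) hdot p.2 (g p.1).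

(** Both sides compute the inner product through one of the arguments only;
    their equality is what makes it independent of the representing sums. *)
Lemma tensor_dotE (f g : tensor_space) :
  tensor_dot f g = \sum_(q <- tensor_repr g) hdot (f q.1) q.2.
Proof.
rewrite /tensor_dot.
under eq_bigr do rewrite tensor_reprE /tensor_sum hdot_sumr.
rewrite exchange_big; apply: eq_bigr => q _ /=.
rewrite tensor_reprE /tensor_sum hdot_suml; apply: eq_bigr => p _.
by rewrite star_rep_adj rdot_star.
Qed.

Let tensor_dotC f g : (tensor_dot f g)^* = tensor_dot g f.
Proof.
rewrite tensor_dotE rmorph_sum; apply: eq_bigr => q _ /=.
by rewrite hdotC.
Qed.

Let tensor_dotDr f g1 g2 :
  tensor_dot f (g1 + g2) = tensor_dot f g1 + tensor_dot f g2.
Proof.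
by rewrite /tensor_dot -big_split; apply: eq_bigr => p _;
  rewrite hdotDr.
Qed.

Let tensor_dotZr c f g : tensor_dot f (c *: g) = c * tensor_dot f g.
Proof.
by rewrite /tensor_dot mulr_sumr; apply: eq_bigr => p _;
  rewrite hdotZr.
Qed.

Let tensor_dot_gram f : tensor_dot f f = gram rho (tensor_repr f).
Proof.
apply: eq_bigr => p _.
by rewrite {1}tensor_reprE /tensor_sum hdot_sumr.
Qed.

Definition tensor_inner (nd : nondegenerate_rep rho) : semi_inner tensor_space.
Proof.
exists tensor_dot => // f; rewrite tensor_dot_gram; exact: gram_ge0.
Defined.

Lemma tensor_subproof x h : (fun y => rho (rdot y x) h) \in tensor_pred.
Proof.
by apply/tensor_predP; exists [:: (x, h)]; apply/funext => y;
  rewrite /tensor_sum big_seq1.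
Qed.

Definition tensor x h : tensor_space := TensorSpace (tensor_subproof x h).

Lemma tensorE x h y : tensor x h y = rho (rdot y x) h.
Proof. by []. Qed.

Lemma tensor_dot_tensor x h (f : tensor_space) :
  tensor_dot (tensor x h) f = hdot h (f x).
Proof.
rewrite tensor_dotE tensor_reprE /tensor_sum hdot_sumr; apply: eq_bigr => p _.
by rewrite tensorE star_rep_adj rdot_star.
Qed.

Lemma tensor_decomposition (f : tensor_space) :
  f = \sum_(p <- tensor_repr f) tensor p.1 p.2.
Proof.
apply: tensor_ext => y; rewrite tensor_reprE /tensor_sum.
by elim/big_rec2: _ => [|p a b _ ->].
Qed.

Lemma tensor_linearl c x y h :
  tensor (c *: x + y) h = c *: tensor x h + tensor y h.
Proof.
apply: tensor_ext => z.
by rewrite tensorE rdotDr rdotZr linearP.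
Qed.

Lemma tensor_linearr x c h k :
  tensor x (c *: h + k) = c *: tensor x h + tensor x k.
Proof. by apply: tensor_ext => z; rewrite tensorE linearP. Qed.

Lemma tensor_balanced x b h : tensor (ract x b) h = tensor x (rho b h).
Proof. by apply: tensor_ext => z; rewrite !tensorE rdotMr star_repM. Qed.

End tensor_space.

Section induced.
Variables (R : realType) (A B : cstarAlgType R) (X : hilbertBimodType A B).
Variables (H0 : hilbertType R) (rho : star_rep B H0).
Hypothesis nd : nondegenerate_rep rho.
Implicit Types (a : A) (x y : X) (h k : H0) (f g : tensor_space X rho).

Local Notation V := (tensor_space X rho).

(** The formula for [tensor_act] is forced by [<y, a x> = <a^* y, x>]; stated on
    functions, it is visibly independent of the representing sum. *)
Lemma tensor_act_subproof a f :
  (fun y => f (lact (cstar a) y)) \in tensor_pred rho.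
Proof.
apply/tensor_predP; exists [seq (lact a p.1, p.2) | p <- tensor_repr f].
apply/funext => y; rewrite tensor_reprE /tensor_sum big_map.
by apply: eq_bigr => p _; rewrite rdot_lact cstarK.
Qed.

Definition tensor_act a f : V := TensorSpace (tensor_act_subproof a f).

Lemma tensor_act_tensor a x h :
  tensor_act a (tensor rho x h) = tensor rho (lact a x) h.
Proof. by apply: tensor_ext => y; rewrite !tensorE /= rdot_lact cstarK. Qed.

Lemma tensor_linear_comb f c x y : f (c *: x + y) = c^* *: f x + f y.
Proof.
rewrite !tensor_reprE /tensor_sum scaler_sumr -big_split; apply: eq_bigr => p _.
by rewrite rdotDl rdotZl linearP.
Qed.

Definition tensor_action : star_action A (tensor_inner X nd).
Proof.
exists tensor_act => [c a b f|c a f g|a b f|a f g].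
- apply: tensor_ext => y /=.
  by rewrite cstarD cstarZ lactDl lactZl tensor_linear_comb conjCK.
- exact: tensor_ext.
- by apply: tensor_ext => y /=; rewrite cstarM lactA.
- rewrite /= tensor_dotE /tensor_dot.
  under [RHS]eq_bigr do rewrite /= cstarK tensor_reprE /tensor_sum hdot_sumr.
  rewrite exchange_big; apply: eq_bigr => q _ /=.
  rewrite tensor_reprE /tensor_sum hdot_suml; apply: eq_bigr => p _.
  by rewrite star_rep_adj rdot_star rdot_lact.
Defined.

Local Notation H1 := (completion (tensor_inner X nd)).

Definition induced_rep : star_rep A H1 := completion_rep tensor_action.

Let embed_tensor x h : H1 := embed (tensor_inner X nd) (tensor rho x h).

(** The square of the left side is [hdot h (rho <x, x> h)], and [<x, x>] is
    self-adjoint of norm [rnorm x ^+ 2]. *)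
Let norm_embed_tensor x h : `|embed_tensor x h| <= rnorm x * `|h|.
Proof.
rewrite norm_embed -(@ler_pXn2r _ 2) ?nnegrE ?mulr_ge0 ?snormC_ge0 ?sqrtC_ge0//.
rewrite snorm_sqr /= tensor_dot_tensor tensorE exprMn sqrtCK -hdot_norm.
apply: (act_selfadjoint_le (star_rep_action rho)); exact: rdot_star.
Qed.

Let embed_tensor_blinear x : embed_tensor x \in blinear.
Proof.
apply/blinearP; split=> [c h k|].
  by rewrite /embed_tensor tensor_linearr embed_linear.
exists (complex.Re (rnorm x)) => h; rewrite RRe_real;
  first exact: norm_embed_tensor.
by rewrite ger0_real// sqrtC_ge0.
Qed.

Definition induced_op x : blin H0 H1 := Blin (embed_tensor_blinear x).

Lemma induced_op_linear c x y :
  induced_op (c *: x + y) = c *: induced_op x + induced_op y.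
Proof.
apply: blin_ext => h.
by rewrite [LHS]/(embed_tensor _ h) /embed_tensor tensor_linearl embed_linear.
Qed.

HB.instance Definition _ :=
  GRing.isLinear.Build _ _ _ _ induced_op induced_op_linear.

Lemma hdot_induced_op x h (v : H1) :
  hdot (induced_op x h) v = v (tensor rho x h).
Proof. exact: hdot_embed. Qed.

Lemma induced_op_bounded : bounded_on_module induced_op.
Proof.
exists 1 => x; rewrite mul1r.
have xr : (complex.Re (rnorm x))%:C = rnorm x.
  by rewrite RRe_real// ger0_real// sqrtC_ge0.
rewrite -xr; apply: opnorm_le => [|h]; last by rewrite xr;
  exact: norm_embed_tensor.
by rewrite -ler0c xr sqrtC_ge0.
Qed.

(** The simple tensors span a dense subspace, so they separate the points of
    the completion. *)
Lemma completion_tensor_ext (v w : H1) :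
  (forall x h, v (tensor rho x h) = w (tensor rho x h)) -> v = w.
Proof.
move=> vw; apply: completion_ext => f; rewrite (tensor_decomposition f).
elim: (tensor_repr f) => [|p l IH].
  by rewrite !big_nil -(scale0r (0 : V)) !completion_scale conjC0 !mul0r.
by rewrite !big_cons !completion_add vw IH.
Qed.

Lemma induced_op_adjoint x y h :
  adjoint (induced_op x) (induced_op y h) = rho (rdot x y) h.
Proof.
apply: hdot_inj => k; rewrite -[LHS]hdotC -adjointP hdotC.
rewrite hdot_induced_op star_rep_adj rdot_star.
exact: tensor_dot_tensor.
Qed.

(** The formula for [ldot x y] expresses the compatibility of the two inner
    products: applied to a simple tensor of [z] and [h], its sides are the
    simple tensors of [<x, y> z] and of [x <y, z>] with [h]. *)
Lemma induced_bimodule_rep : bimodule_rep induced_rep rho induced_op.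
Proof.
split.
- move=> a x; apply: blin_ext => h /=.
  by rewrite [RHS]completion_op_embed /= tensor_act_tensor.
- by move=> b x; apply: blin_ext => h; rewrite /= /embed_tensor tensor_balanced.
- move=> x y; apply: blin_ext => v; apply: completion_tensor_ext => z h.
  rewrite -[RHS]/(induced_op x (adjoint (induced_op y) v) (tensor rho z h)).
  rewrite -[RHS]hdot_induced_op -[RHS]hdotC adjointP induced_op_adjoint hdotC.
  rewrite -adjointP hdot_induced_op.
  rewrite -[LHS]/(v (tensor_act (cstar (ldot x y)) (tensor rho z h))).
  by rewrite tensor_act_tensor ldot_star ldot_rdot tensor_balanced.
- by move=> x y; apply: blin_ext => h; rewrite /= induced_op_adjoint.
Qed.

(** If [w] is orthogonal to the range of the representation, then the squared
    norm of [adjoint (induced_op x) w], which is the inner product of [w] with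
    the image of [w] under [ldot x x], vanishes. So [w] is orthogonal to all
    simple tensors. *)
Lemma induced_rep_nondegenerate : nondegenerate_rep induced_rep.
Proof.
apply: dense_of_trivial_orthogonal; first exact: linear_span_subspace.
move=> w wS; apply: completion_tensor_ext => x h; rewrite -[LHS]hdot_induced_op.
suff u0 : adjoint (induced_op x) w = 0 by rewrite adjointP u0 hdot0r.
apply/eqP; rewrite -normr_eq0 -sqrf_eq0 -hdot_norm -adjointP; apply/eqP.
apply: wS; apply: sub_linear_span; exists (ldot x x), w.
by rewrite (bimodule_rep_ldot induced_bimodule_rep).
Qed.

End induced.

Theorem theorem4p4 (R : realType) (A B : cstarAlgType R)
    (X : hilbertBimodType A B) (H0 : hilbertType R) (rho : star_rep B H0) :
  nondegenerate_rep rho ->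
  exists (H1 : hilbertType R) (lam : star_rep A H1)
         (pi : {linear X -> blin H0 H1}),
    [/\ nondegenerate_rep lam, bounded_on_module pi & bimodule_rep lam rho pi].
Proof.
move=> nd; exists _, (induced_rep X nd), (induced_op (X := X) nd); split.
- exact: induced_rep_nondegenerate.
- exact: induced_op_bounded.
- exact: induced_bimodule_rep.
Qed.
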